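(* Let $L$ be a compact semisimple Lie algebra, and let $a$ be a regular element of $L$. Then there exists a regular element $b$ in $L$ such that $$L=[a,L]+[b,L]$$ and $a,b$ are orthogonal with respect to the negative of the Killing form of $L$; in fact the centralizers of $a$ and $b$ in $L$ are also orthogonal.
   Context: A compact semisimple Lie algebra is the Lie algebra of a compact semisimple Lie group. An element $a\in L$ is regular if its centralizer $Z(a)=\{y\in L:[a,y]=0\}$ is a Cartan subalgebra of $L$. Here $[a,L]=\{[a,y]:y\in L\}$. Two subspaces are orthogonal if every element of one is orthogonal to every element of the other. *)

(* Defs.v *)
From HB Require Import structures.
From mathcomp Require Import all_boot all_order all_algebra.
From mathcomp Require Import sesquilinear boolp classical_sets functions reals.
From mathcomp Require Import topology normedtype derive.

Set Implicit Arguments.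
Unset Strict Implicit.
Unset Printing Implicit Defensive.

Import Order.TTheory GRing.Theory Num.Theory.
Import numFieldNormedType.Exports.

Local Open Scope classical_set_scope.
Local Open Scope ring_scope.

(** * Finite-dimensional Lie algebras *)

HB.mixin Record Vector_isLieAlgebra (K : fieldType) L of Vector K L := {
  lie : L -> L -> L;
  lie_bilinear : bilinear_for *:%R *:%R lie;
  liexx : forall x, lie x x = 0;
  lie_jacobi : forall x y z,
    lie x (lie y z) + lie y (lie z x) + lie z (lie x y) = 0
}.

#[short(type="lieAlgebraType")]
HB.structure Definition LieAlgebra (K : fieldType) :=
  {L of Vector_isLieAlgebra K L & Vector K L}.

HB.instance Definition _ (K : fieldType) (L : lieAlgebraType K) :=
  bilinear_isBilinear.Build K L L L *:%R *:%R (@lie K L) lie_bilinear.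

HB.instance Definition _ (K : fieldType) (L : lieAlgebraType K) (x : L) :=
  GRing.isLinear.Build K L L *:%R (lie x) (lie_bilinear.2 x).

Section LieAlgebraTheory.
Context {K : fieldType} {L : lieAlgebraType K}.
Implicit Types (x y : L) (U V H I : {vspace L}).

Definition ad x : 'End(L) := linfun (lie x).

Definition centralizer x : {vspace L} := lker (ad x).

Definition killing x y : K :=
  \tr (passmx.mxof (vbasis fullv) (vbasis fullv) (ad x \o ad y)%VF).

(* [U, V]: by bilinearity the brackets of basis vectors span it. *)
Definition lie_space U V : {vspace L} :=
  <<[seq lie u v | u <- vbasis U, v <- vbasis V]>>%VS.

Definition subalgebra H := (lie_space H H <= H)%VS.

Definition ideal I := (lie_space fullv I <= I)%VS.

Definition solvable_space H :=
  exists n, iter n (fun U => lie_space U U) H = 0%VS.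

Definition nilpotent_space H := exists n, iter n (lie_space H) H = 0%VS.

Definition self_normalizing H :=
  forall x, (forall y, y \in H -> lie x y \in H) -> x \in H.

Definition cartan_subalgebra H :=
  [/\ subalgebra H, nilpotent_space H & self_normalizing H].

Definition regular x := cartan_subalgebra (centralizer x).

End LieAlgebraTheory.

Definition semisimple (K : fieldType) (L : lieAlgebraType K) :=
  forall I : {vspace L}, ideal I -> solvable_space I -> I = 0%VS.

(** * Smooth maps between open subsets of normed spaces *)

Fixpoint Ck_on (R : realType) (V W : normedModType R) (k : nat) (U : set V)
    (f : V -> W) : Prop :=
  if k is k'.+1 then
    (forall x, U x -> differentiable f x) /\
    (forall v, Ck_on k' U (fun x => 'D_v f x))
  else {in U, continuous f}.

(* Only meant for open U: the derivatives at a point of U are taken in V. *)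
Definition smooth_on (R : realType) (V W : normedModType R) (U : set V)
    (f : V -> W) := forall k, Ck_on k U f.

(** * Lie groups *)

(* The maps cmap and cinv are total but only meaningful on cdom, resp. on the
   image of cdom. *)
Record chart (R : realType) (n : nat) (M : topologicalType) := Chart {
  cdom : set M;
  cmap : M -> 'rV[R]_n;
  cinv : 'rV[R]_n -> M;
  cdom_open : open cdom;
  cimg_open : open (cmap @` cdom);
  cmapK : {in cdom, cancel cmap cinv};
  cmap_continuous : {in cdom, continuous cmap};
  cinv_continuous : {in cmap @` cdom, continuous cinv}
}.

Definition cimg (R : realType) (n : nat) (M : topologicalType)
  (c : chart R n M) : set 'rV[R]_n := cmap c @` cdom c.

(* An atlas, presented as the choice of a chart around each point. *)
Record atlas (R : realType) (n : nat) (M : topologicalType) := Atlas {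
  chart_at :> M -> chart R n M;
  chart_atP : forall p, cdom (chart_at p) p;
  chart_at_compat : forall p q,
    smooth_on (cmap (chart_at p) @` (cdom (chart_at p) `&` cdom (chart_at q)))
              (cmap (chart_at q) \o cinv (chart_at p))
}.

HB.mixin Record isTopologicalGroup G of Group G & Topological G := {
  mulg_continuous : continuous (fun p : G * G => (p.1 * p.2)%g);
  invg_continuous : continuous (fun x : G => (x^-1)%g)
}.

#[short(type="topologicalGroupType")]
HB.structure Definition TopologicalGroup :=
  {G of isTopologicalGroup G & Group G & Topological G}.

Record lieGroup (R : realType) := LieGroup {
  lgcarrier :> topologicalGroupType;
  lgdim : nat;
  lgatlas : atlas R lgdim lgcarrier;
  lg_hausdorff : hausdorff_space lgcarrier;
  lg_second_countable : @second_countable lgcarrier;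
  lg_mul_smooth : forall p q r : lgcarrier,
    smooth_on
      [set u : 'rV[R]_lgdim * 'rV[R]_lgdim |
        [/\ cimg (lgatlas p) u.1, cimg (lgatlas q) u.2 &
            cdom (lgatlas r) (cinv (lgatlas p) u.1 * cinv (lgatlas q) u.2)%g]]
      (fun u =>
        cmap (lgatlas r) (cinv (lgatlas p) u.1 * cinv (lgatlas q) u.2)%g);
  lg_inv_smooth : forall p q : lgcarrier,
    smooth_on
      [set u | cimg (lgatlas p) u /\
               cdom (lgatlas q) ((cinv (lgatlas p) u)^-1)%g]
      (fun u => cmap (lgatlas q) ((cinv (lgatlas p) u)^-1)%g)
}.

Section LieAlgebraOfLieGroup.
Context {R : realType} (G : lieGroup R).
Local Notation E := 'rV[R]_(lgdim G).

(* The tangent space of G at 1 is identified with E by the chart at 1, and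
   vector fields near 1 are written in the coordinates of this chart. *)
Let c1 := lgatlas G 1%g.
Let o : E := cmap c1 1%g.

Definition mul_coord (u v : E) : E := cmap c1 (cinv c1 u * cinv c1 v)%g.

(* The left-invariant vector field with value X at 1: its value at g is the
   image of X under the differential at 1 of h |-> g * h. *)
Definition left_invariant (X : E) : E -> E := fun u => 'D_X (mul_coord u) o.

Definition vector_field_bracket (V W : E -> E) : E -> E :=
  fun u => 'D_(V u) W u - 'D_(W u) V u.

Definition tangent_bracket (X Y : E) : E :=
  vector_field_bracket (left_invariant X) (left_invariant Y) o.

(* L is isomorphic to the Lie algebra of G. *)
Definition is_lie_algebra_of (L : lieAlgebraType R) :=
  exists f : {linear L -> E},
    bijective f /\ forall x y, f (lie x y) = tangent_bracket (f x) (f y).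

End LieAlgebraOfLieGroup.

(* A Lie group is semisimple when its Lie algebra is; replacing G by its
   identity component changes neither compactness nor the Lie algebra, so
   connectedness is not required. *)
Definition compact_semisimple (R : realType) (L : lieAlgebraType R) :=
  exists G : lieGroup R,
    [/\ compact [set: G], is_lie_algebra_of G L & semisimple L].

(** * Orthogonality for the negative of the Killing form *)

Definition neg_killing (K : fieldType) (L : lieAlgebraType K) (x y : L) : K :=
  - killing x y.

Definition orthogonal_vect (K : fieldType) (L : lieAlgebraType K) (x y : L) :=
  neg_killing x y = 0.

Definition orthogonal_space (K : fieldType) (L : lieAlgebraType K)
    (U V : {vspace L}) :=
  forall x y, x \in U -> y \in V -> orthogonal_vect x y.

(* Main.v *)
From HB Require Import structures.
Require Import Defs.
From mathcomp Require Import all_boot all_order all_algebra.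
From mathcomp Require Import boolp classical_sets functions reals.
From mathcomp Require Import interval_inference topology normedtype landau.
From mathcomp Require Import derive realfun sequences sesquilinear.
From mathcomp Require Import complex spectral.
From mathcomp Require Import ring lra.

(** Write <x, y> for the negative of the Killing form. The proof first shows
    that <,> is an inner product, and then works with ad-invariance and
    positivity alone.

    Positivity ([neg_killing_gt0]). Let G be compact with Lie algebra L. By
    compactness the entries of Ad g are bounded uniformly in g ([Ad_bounded]),
    and in a chart u_t = o + t X one has Ad (u_t) = 1 + t ad X + o(t)
    ([Ad_derive]). The latter comes from the identity g v = (g v g^-1) g, which
    expresses Ad by the two partial derivatives of the multiplication, and from
    the symmetry of its second derivatives, which turns the difference of
    these partial derivatives into the bracket of left-invariant fields. Put
    B_k = Ad (u_(1/k)). All powers of B_k are bounded, so the averages of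
    B_k^j (B_k^j)^T over j < k^2 stay between two positive multiples of the
    identity, and they are almost invariant under B_k. A limit point Q is
    positive definite and A = ad X satisfies A Q + Q A^T = 0
    ([bounded_powers_skew]). So A is skew for some inner product, and
    tr (A^2) <= 0 with equality only for A = 0 ([skew_trace_sq]). Finally
    ad X = 0 forces X = 0, since the line of X would be an abelian ideal.

    Reduction. As ad a is skew, the orthogonal of [a, L] is Z(a). Hence
    [a, L] + [b, L] = L as soon as Z(a) and Z(b) are orthogonal, for then
    Z(a) and Z(b) meet in 0. It remains to find, for H = Z(a), a regular b
    such that Z(b) is orthogonal to H ([orthogonal_regular]).

    Construction of b. H is abelian, because a nilpotent subalgebra on which
    every ad h is skew is abelian ([nilpotent_abelian]). The commuting skew maps
    ad h, for h in H, split the complement of H into planes with bases (u, v)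
    on which [h, u] = <h, t> v and [h, v] = - <h, t> u, for certain nonzero t in
    H, the real roots; they are finite in number, closed under t -> -t, and they
    span H ([span_roots]). Let S consist of the simple roots for the order given
    by <a, .> and of the lowest root of each component. What is used about S is:
    the difference of two distinct members is not a root
    ([indecomposables_diff]), every root is a sum of members
    ([indecomposables_span]), and sum m_s s = 0 for some positive integers m_s
    ([indecomposables_relation]). With c_s^2 <v_s, v_s> = m_s put
    p = sum c_s u_s and q = sum c_s v_s; p + i q is the cyclic element of
    Kostant, up to normalization. As differences of members of S are not roots,
    the cross terms cancel in [p, v_s] - [q, u_s], which is thus a nonzero
    multiple of s. Weighted by c_s and summed, these equalities give
    2 [p, q] = 2 sum m_s s = 0. And if y commutes with p and q, then y is
    orthogonal to [p, v_s] - [q, u_s] by invariance, so to every s in S, so to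
    the span H of the roots. Since p and q commute, some regular b has its
    centralizer inside Z(p) and Z(q) ([commuting_regular]), and this b is as
    required. *)

Set Implicit Arguments.
Unset Strict Implicit.
Unset Printing Implicit Defensive.

Import Order.TTheory GRing.Theory Num.Theory.
Import numFieldNormedType.Exports.
Import passmx.

Local Open Scope classical_set_scope.
Local Open Scope ring_scope.

(** * Jacobians and equality of mixed derivatives *)

Lemma near_eq_diff (R : realType) (V W : normedModType R) (f g : V -> W) x :
  (\near x, f x = g x) -> differentiable g x ->
  differentiable f x /\ 'd f x = 'd g x :> (V -> W).
Proof.
move=> fg dg.
have fgx : f x = g x by exact: nbhs_singleton fg.
have key : f \o shift x = cst (f x) + 'd g x +o_ 0 id.
  have := diff_locally dg.
  rewrite fgx => /eqaddoP h; apply/eqaddoP => e e0.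
  have {}h := h e e0.
  have fg0 : \forall y \near (0 : V), f (y + x) = g (y + x).
    have := near_shift 0 x (fun y => f y = g y).
    by rewrite /comp /shift /= subr0 => <-.
  by apply: filterS2 fg0 h => y eq; rewrite !fctE /= eq.
have dE : 'd f x = 'd g x :> (V -> W).
  by apply: diff_unique key; exact: diff_continuous.
split => //; apply/diff_locallyP; split.
  by rewrite dE; exact: diff_continuous.
by rewrite dE.
Qed.

Lemma mul_jacobian (R : realType) n m (f : 'rV[R]_n -> 'rV[R]_m) x u :
  u *m 'J f x = 'd f x u.
Proof. exact: mul_rV_lin1. Qed.

Lemma jacobian_comp (R : realType) n m p (f : 'rV[R]_n -> 'rV[R]_m)
    (g : 'rV[R]_m -> 'rV[R]_p) x :
  differentiable f x -> differentiable g (f x) ->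
  'J (g \o f) x = 'J f x *m 'J g (f x).
Proof.
move=> df dg; apply/row_matrixP => i.
rewrite !rowE mulmxA !mul_jacobian.
exact: (congr1 (fun F => F _) (diff_comp df dg)).
Qed.

Lemma near_eq_jacobian (R : realType) n m (f g : 'rV[R]_n -> 'rV[R]_m) x :
  (\near x, f x = g x) -> differentiable g x -> 'J f x = 'J g x.
Proof.
move=> fg dg; have [_ e] := near_eq_diff fg dg.
apply/row_matrixP => i; transitivity ('d f x (delta_mx 0 i)).
  by rewrite rowE; exact: mul_jacobian.
rewrite e; symmetry; by rewrite rowE; exact: mul_jacobian.
Qed.

Lemma jacobian_derive (R : realType) n m (f : 'rV[R]_n -> 'rV[R]_m) x i :
  differentiable f x -> row i ('J f x) = 'D_(delta_mx 0 i) f x.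
Proof. by move=> df; rewrite rowE mul_jacobian deriveE. Qed.

Lemma is_derive_line (R : realType) (V : normedModType R) (f : V -> R)
    (q v : V) (t : R) (l : R) :
  is_derive (q + t *: v) v f l ->
  is_derive t 1 (fun x : R => f (q + x *: v)) l.
Proof.
have e : (fun h : R => h^-1 *: (((fun x : R => f (q + x *: v)) \o shift t) (h *: 1)
    - f (q + t *: v))) =
  (fun h : R => h^-1 *: ((f \o shift (q + t *: v)) (h *: v) - f (q + t *: v))).
  apply/funext => h /=; congr (_ *: (f _ - _)).
  by rewrite scalerDl addrCA /GRing.scale /= mulr1.
by move=> [d1 d2]; split; rewrite /derivable /derive e.
Qed.

(** The second difference of f over a small square, computed by two mean value
    theorems; computing it in the other order gives the other mixed derivative,
    which is how [schwarz] compares the two. *)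
Lemma second_difference (R : realType) (V : normedModType R)
    (f fv fvw : V -> R) (p v w : V) (s : R) : 0 < s ->
  (forall a b, a \in `[0, s] -> b \in `[0, s] ->
     is_derive (p + a *: v + b *: w) v f (fv (p + a *: v + b *: w))) ->
  (forall a b, a \in `[0, s] -> b \in `[0, s] ->
     is_derive (p + a *: v + b *: w) w fv (fvw (p + a *: v + b *: w))) ->
  exists a b, [/\ a \in `[0, s], b \in `[0, s] &
    f (p + s *: v + s *: w) - f (p + s *: v) - f (p + s *: w) + f p =
    s * (s * fvw (p + a *: v + b *: w))].
Proof.
move=> s0 df dfv.
have in0 : 0 \in `[0, s] by rewrite in_itv /= lexx ltW.
have ins : s \in `[0, s] by rewrite in_itv /= lexx ltW.
have sub a : a \in `]0, s[ -> a \in `[0, s] by rewrite !in_itv /= => /andP[/ltW -> /ltW ->].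
pose phi (t : R) := f (p + s *: w + t *: v) - f (p + t *: v).
have dphi t : t \in `[0, s] ->
    is_derive t 1 phi (fv (p + t *: v + s *: w) - fv (p + t *: v)).
  move=> ts; apply: is_deriveB; apply: is_derive_line.
    by rewrite addrAC; exact: df.
  have := df t 0 ts in0; by rewrite scale0r addr0.
have cont (g dg : R -> R) : (forall t, t \in `[0, s] -> is_derive t 1 g (dg t)) ->
    {within `[0, s], continuous g}.
  move=> h; apply: derivable_within_continuous => t /h [] //.
have [a ain ea] := MVT s0 (fun t ts => dphi t (sub _ ts)) (cont _ _ dphi).
pose psi (t : R) := fv (p + a *: v + t *: w).
have dpsi t : t \in `[0, s] -> is_derive t 1 psi (fvw (p + a *: v + t *: w)).
  by move=> ts; apply: is_derive_line; apply: dfv => //; exact: sub.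
have [b bin eb] := MVT s0 (fun t ts => dpsi t (sub _ ts)) (cont _ _ dpsi).
exists a, b; split; [exact: sub|exact: sub|].
move: ea eb; rewrite /phi /psi !scale0r !addr0 !subr0 => ea eb.
rewrite [RHS]mulrC (mulrC s) -eb -ea addrAC [p + s *: w + _]addrAC; ring.
Qed.

Lemma schwarz (R : realType) (V : normedModType R)
    (f fv fw fvw fwv : V -> R) (p v w : V) :
  (\forall x \near p, is_derive x v f (fv x)) ->
  (\forall x \near p, is_derive x w f (fw x)) ->
  (\forall x \near p, is_derive x w fv (fvw x)) ->
  (\forall x \near p, is_derive x v fw (fwv x)) ->
  {for p, continuous fvw} -> {for p, continuous fwv} ->
  fvw p = fwv p.
Proof.
move=> dv dw dvw dwv cvw cwv.
apply/eqP; rewrite -subr_eq0 -normr_le0; apply/ler_addgt0Pr => e e0; rewrite add0r.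
have e2 : 0 < e / 2 by rewrite divr_gt0.
have near1 : \forall x \near p, [/\ is_derive x v f (fv x), is_derive x w f (fw x),
    is_derive x w fv (fvw x) & is_derive x v fw (fwv x)] /\
    (`|fvw p - fvw x| < e / 2 /\ `|fwv p - fwv x| < e / 2).
  near=> x; split; first by split; near: x.
  by split; near: x; [move: (cvw) | move: (cwv)] => /cvgrPdist_lt; apply.
have sq : (fun s : R * R => p + s.1 *: v + s.2 *: w) @ (0, 0) --> p.
  have -> : nbhs p = nbhs (p + (0 : R) *: v + (0 : R) *: w) by rewrite !scale0r !addr0.
  apply: cvgD; [apply: cvgD; [exact: cvg_cst|]|]; apply: cvgZr_tmp; [exact: cvg_fst|exact: cvg_snd].
have /= := sq _ near1 => -[[A B] /= [An Bn] AB].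
have [r /= r0 rA] := (nbhs_ballP 0 A).1 An.
have [r' /= r'0 rB] := (nbhs_ballP 0 B).1 Bn.
pose s := Num.min r r' / 2.
have s0 : 0 < s by rewrite divr_gt0 // lt_min r0 r'0.
have sr : s < r /\ s < r'.
  have : s < Num.min r r' by rewrite ltr_pdivrMr // ltr_pMr ?ltr1n // lt_min r0 r'0.
  by rewrite lt_min => /andP.
have H a b : a \in `[0, s] -> b \in `[0, s] ->
    [/\ is_derive (p + a *: v + b *: w) v f (fv (p + a *: v + b *: w)),
      is_derive (p + a *: v + b *: w) w f (fw (p + a *: v + b *: w)),
      is_derive (p + a *: v + b *: w) w fv (fvw (p + a *: v + b *: w)) &
      is_derive (p + a *: v + b *: w) v fw (fwv (p + a *: v + b *: w))] /\
    (`|fvw p - fvw (p + a *: v + b *: w)| < e / 2 /\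
     `|fwv p - fwv (p + a *: v + b *: w)| < e / 2).
  have [sr1 sr2] := sr.
  rewrite !in_itv /= => /andP[a0 als] /andP[b0 bs].
  apply: (AB (a, b)); split => /=.
    by apply: rA; rewrite /ball /= sub0r normrN ger0_norm // (le_lt_trans als).
  by apply: rB; rewrite /ball /= sub0r normrN ger0_norm // (le_lt_trans bs).
have [||a [b [ain bin e1]]] := @second_difference _ _ f fv fvw p v w s s0.
- by move=> a b ha hb; have [[]] := H a b ha hb.
- by move=> a b ha hb; have [[]] := H a b ha hb.
have [||b' [a' [b'in a'in e3]]] := @second_difference _ _ f fw fwv p w v s s0.
- by move=> a' b' ha hb; rewrite addrAC; have [[]] := H b' a' hb ha.
- by move=> a' b' ha hb; rewrite addrAC; have [[]] := H b' a' hb ha.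
have eq : fvw (p + a *: v + b *: w) = fwv (p + a' *: v + b' *: w).
  apply: (mulfI (lt0r_neq0 s0)); apply: (mulfI (lt0r_neq0 s0)).
  rewrite -e1 [p + a' *: v + _]addrAC -e3 [p + s *: v + _]addrAC; ring.
have [_ [h1 _]] := H a b ain bin.
have [_ [_ h2]] := H a' b' a'in b'in.
rewrite eq in h1.
have -> : fvw p - fwv p = (fvw p - fwv (p + a' *: v + b' *: w)) -
  (fwv p - fwv (p + a' *: v + b' *: w)) by ring.
by rewrite (le_trans (ler_normB _ _)) // [leRHS]splitr lerD // ltW.
Unshelve. all: by end_near. Qed.

(** * Entrywise limits of matrices *)

Section MatrixLimits.
Context {R : realType} {T : Type} (F : set_system T) {FF : Filter F}.

(** Entrywise, since products, determinants and adjugates are polynomials in the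
    entries: each limit below reduces to limits of real sums and products. *)
Definition mcvg m n (A : T -> 'M[R]_(m, n)) (B : 'M[R]_(m, n)) :=
  forall i j, A t i j @[t --> F] --> B i j.

Lemma mcvg_cst m n (B : 'M[R]_(m, n)) : mcvg (fun=> B) B.
Proof. by move=> i j; exact: cvg_cst. Qed.

Lemma cvg_sumr (I : Type) (r : seq I) (P : pred I) (f : I -> T -> R) (l : I -> R) :
  (forall i, P i -> f i t @[t --> F] --> l i) ->
  (\sum_(i <- r | P i) f i t) @[t --> F] --> \sum_(i <- r | P i) l i.
Proof.
move=> h; elim: r => [|i r IH].
  by rewrite big_nil; under eq_fun do rewrite big_nil; exact: cvg_cst.
rewrite big_cons; under eq_fun do rewrite big_cons.
by case: ifP => // Pi; apply: cvgD => //; exact: h.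
Qed.

Lemma cvg_prodr (I : Type) (r : seq I) (P : pred I) (f : I -> T -> R) (l : I -> R) :
  (forall i, P i -> f i t @[t --> F] --> l i) ->
  (\prod_(i <- r | P i) f i t) @[t --> F] --> \prod_(i <- r | P i) l i.
Proof.
move=> h; elim: r => [|i r IH].
  by rewrite big_nil; under eq_fun do rewrite big_nil; exact: cvg_cst.
rewrite big_cons; under eq_fun do rewrite big_cons.
by case: ifP => // Pi; apply: cvgM => //; exact: h.
Qed.

Lemma mcvgD m n (A B : T -> 'M[R]_(m, n)) A' B' :
  mcvg A A' -> mcvg B B' -> mcvg (fun t => A t + B t) (A' + B').
Proof.
move=> hA hB i j; rewrite mxE; under eq_fun do rewrite mxE.
by apply: cvgD; [exact: hA|exact: hB].
Qed.

Lemma mcvgM m n p (A : T -> 'M[R]_(m, n)) (B : T -> 'M[R]_(n, p)) A' B' :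
  mcvg A A' -> mcvg B B' -> mcvg (fun t => A t *m B t) (A' *m B').
Proof.
move=> hA hB i j; rewrite mxE; under eq_fun do rewrite mxE.
by apply: cvg_sumr => k _; apply: cvgM; [exact: hA|exact: hB].
Qed.

Lemma mcvg_tr m n (A : T -> 'M[R]_(m, n)) A' :
  mcvg A A' -> mcvg (fun t => (A t)^T) A'^T.
Proof. by move=> h i j; rewrite mxE; under eq_fun do rewrite mxE; exact: h. Qed.

Lemma cvg_det n (A : T -> 'M[R]_n) A' :
  mcvg A A' -> \det (A t) @[t --> F] --> \det A'.
Proof.
move=> h; rewrite /determinant; apply: cvg_sumr => s _; apply: cvgM; first exact: cvg_cst.
by apply: cvg_prodr => i _; exact: h.
Qed.

Lemma mcvg_adj n (A : T -> 'M[R]_n) A' :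
  mcvg A A' -> mcvg (fun t => \adj (A t)) (\adj A').
Proof.
move=> h i j; rewrite mxE; under eq_fun do rewrite mxE.
apply: cvgM; first exact: cvg_cst.
apply: cvg_det => a b; rewrite !mxE; under eq_fun do rewrite !mxE; exact: h.
Qed.

(** Cramer's rule: the inverse is the adjugate over the determinant, both
    polynomial in the entries. *)
Lemma mcvg_inv n (A : T -> 'M[R]_n) A' : A' \in unitmx ->
  mcvg A A' ->
  (\forall t \near F, A t \in unitmx) /\ mcvg (fun t => invmx (A t)) (invmx A').
Proof.
move=> uA' h; have hd := cvg_det h.
have dA' : \det A' != 0 by rewrite -unitfE.
have un : \forall t \near F, A t \in unitmx.
  have nz : \forall t \near F, \det (A t) != 0 by exact: cvgr_neq0 hd dA'.
  by near=> t; rewrite unitmxE unitfE; near: t.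
split => // i j.
have -> : invmx A' i j = (\det A')^-1 * \adj A' i j.
  by rewrite /invmx uA' [in LHS]mxE.
have near_e : \forall t \near F, (\det (A t))^-1 * \adj (A t) i j = invmx (A t) i j.
  near=> t.
  have ut : A t \in unitmx by near: t.
  by rewrite /invmx ut [in RHS]mxE.
apply: cvg_trans (near_eq_cvg near_e) _.
by apply: cvgM; [exact: cvgV|exact: mcvg_adj].
Unshelve. all: by end_near. Qed.

End MatrixLimits.

(** * The adjoint representation of a Lie group *)

Section Adjoint.
Variables (R : realType) (G : lieGroup R).
Local Notation E := 'rV[R]_(lgdim G).
Local Notation ch := (lgatlas G).
Local Notation c1 := (ch 1%g).
Local Notation o := (cmap c1 1%g).
Implicit Types (g h x y : G) (u v w : E).

Lemma nbhs_cdom g x : cdom (ch g) x -> \forall y \near x, cdom (ch g) y.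
Proof. by move=> gx; apply: open_nbhs_nbhs; split => //; exact: cdom_open. Qed.

Lemma nbhs_cimg g x : cdom (ch g) x ->
  \forall u \near cmap (ch g) x, cimg (ch g) u.
Proof.
move=> gx; apply: open_nbhs_nbhs; split; first exact: cimg_open.
by exists x.
Qed.

Lemma cmap_cinv g x : cdom (ch g) x -> cinv (ch g) (cmap (ch g) x) = x.
Proof. by move=> gx; apply: (cmapK (c := ch g)); exact: mem_set. Qed.

Lemma cinv_cmap g u : cimg (ch g) u -> cmap (ch g) (cinv (ch g) u) = u.
Proof. by move=> [x gx <-]; rewrite cmap_cinv. Qed.

Lemma cdom_cinv g u : cimg (ch g) u -> cdom (ch g) (cinv (ch g) u).
Proof. by move=> [x gx <-]; rewrite cmap_cinv. Qed.

Lemma cinv_cvg g x : cdom (ch g) x ->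
  cinv (ch g) u @[u --> cmap (ch g) x] --> x.
Proof.
move=> gx; rewrite -[X in _ --> X](cmap_cinv gx).
by apply: (cinv_continuous (c := ch g)); apply/mem_set; exists x.
Qed.

Lemma cmap_cvg g x : cdom (ch g) x ->
  cmap (ch g) y @[y --> x] --> cmap (ch g) x.
Proof. by move=> gx; apply: (cmap_continuous (c := ch g)); apply/mem_set. Qed.

Lemma mulgG_cvg (T : Type) (F : set_system T) (f g : T -> G) x y : Filter F ->
  f @ F --> x -> g @ F --> y -> (f t * g t)%g @[t --> F] --> (x * y)%g.
Proof.
move=> FF fx gy.
have := @mulg_continuous G (x, y).
move=> /(_ _ _)/= mc; apply: (cvg_comp2 fx gy); exact: mc.
Qed.

(** The product of the group read in charts: p and q index the charts of the
    factors, r the chart of the result. *)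
Definition mulc p q r (u : E * E) : E :=
  cmap (ch r) (cinv (ch p) u.1 * cinv (ch q) u.2)%g.

Definition mulc_dom p q r : set (E * E) :=
  [set u | [/\ cimg (ch p) u.1, cimg (ch q) u.2 &
     cdom (ch r) (cinv (ch p) u.1 * cinv (ch q) u.2)%g]].

Lemma mulc_smooth p q r : smooth_on (mulc_dom p q r) (mulc p q r).
Proof. exact: lg_mul_smooth. Qed.

Lemma nbhs_mulc_dom p q r x y :
  cdom (ch p) x -> cdom (ch q) y -> cdom (ch r) (x * y)%g ->
  \forall u \near (cmap (ch p) x, cmap (ch q) y), mulc_dom p q r u.
Proof.
move=> px qy rxy.
have f1 : u.1 @[u --> (cmap (ch p) x, cmap (ch q) y)] --> cmap (ch p) x.
  exact: cvg_fst.
have f2 : u.2 @[u --> (cmap (ch p) x, cmap (ch q) y)] --> cmap (ch q) y.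
  exact: cvg_snd.
have h1 : \forall u \near (cmap (ch p) x, cmap (ch q) y), cimg (ch p) u.1.
  exact: f1 _ (nbhs_cimg px).
have h2 : \forall u \near (cmap (ch p) x, cmap (ch q) y), cimg (ch q) u.2.
  exact: f2 _ (nbhs_cimg qy).
have m := mulgG_cvg _ (cvg_comp _ _ f1 (cinv_cvg px)) (cvg_comp _ _ f2 (cinv_cvg qy)).
have h3 : \forall u \near (cmap (ch p) x, cmap (ch q) y),
    cdom (ch r) (cinv (ch p) u.1 * cinv (ch q) u.2)%g.
  exact: m _ _ (nbhs_cdom rxy).
by apply: filterS3 h1 h2 h3 => u.
Qed.

Lemma mulc_diff p q r x y :
  cdom (ch p) x -> cdom (ch q) y -> cdom (ch r) (x * y)%g ->
  differentiable (mulc p q r) (cmap (ch p) x, cmap (ch q) y).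
Proof.
move=> px qy rxy; have [h _] := mulc_smooth p q r 1; apply: h.
exact: nbhs_singleton (nbhs_mulc_dom px qy rxy).
Qed.

Lemma cdom_self g : cdom (ch g) g. Proof. exact: chart_atP. Qed.

(** One-sided translations in charts. Conjugation by g is composed of two of
    them through a chart at g, since left translation by g leaves the chart
    at 1. *)
Definition lmulc p r g v : E := cmap (ch r) (g * cinv (ch p) v)%g.
Definition rmulc p r g v : E := cmap (ch r) (cinv (ch p) v * g)%g.

Lemma lmulcE p r g v : lmulc p r g v = mulc g p r (cmap (ch g) g, v).
Proof. by rewrite /lmulc /mulc /= cmap_cinv //; exact: cdom_self. Qed.

Lemma rmulcE p r g v : rmulc p r g v = mulc p g r (v, cmap (ch g) g).
Proof. by rewrite /rmulc /mulc /= cmap_cinv //; exact: cdom_self. Qed.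

Lemma lmulc_diff p r g x : cdom (ch p) x -> cdom (ch r) (g * x)%g ->
  differentiable (lmulc p r g) (cmap (ch p) x).
Proof.
move=> px rgx.
have -> : lmulc p r g = mulc g p r \o (fun v => (cmap (ch g) g, v)).
  by apply/funext => v; rewrite /= lmulcE.
apply: differentiable_comp.
  by apply: differentiable_pair; [exact: differentiable_cst|].
by apply: mulc_diff => //; exact: cdom_self.
Qed.

Lemma rmulc_diff p r g x : cdom (ch p) x -> cdom (ch r) (x * g)%g ->
  differentiable (rmulc p r g) (cmap (ch p) x).
Proof.
move=> px rgx.
have -> : rmulc p r g = mulc p g r \o (fun v => (v, cmap (ch g) g)).
  by apply/funext => v; rewrite /= rmulcE.
apply: differentiable_comp.
  by apply: differentiable_pair; [|exact: differentiable_cst].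
by apply: mulc_diff => //; exact: cdom_self.
Qed.

Definition conjc g v : E := cmap c1 (g * cinv c1 v * g^-1)%g.

Lemma conjc1 g : conjc g o = o.
Proof.
by rewrite /conjc cmap_cinv ?mulg1 ?mulgV //; exact: cdom_self.
Qed.

(** Conjugation is a right translation after a left one as long as g x stays in
    the chart at g, which holds for x near 1. *)
Lemma conjc_near g :
  \forall v \near o, conjc g v = (rmulc g 1%g g^-1%g \o lmulc 1%g g g) v.
Proof.
have m : (g * cinv c1 v)%g @[v --> o] --> g.
  rewrite -[X in _ --> X]mulg1.
  apply: (@mulgG_cvg _ (nbhs o) (fun=> g)); first exact: cvg_cst.
  by apply: cinv_cvg; exact: cdom_self.
have h : \forall v \near o, cdom (ch g) (g * cinv c1 v)%g.
  exact: m _ (nbhs_cdom (cdom_self g)).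
by near=> v; rewrite /conjc /rmulc /lmulc /= [in RHS]cmap_cinv //; near: v.
Unshelve. all: by end_near. Qed.

Lemma conjc_diff g : differentiable (conjc g) o.
Proof.
have [] // := near_eq_diff (conjc_near g).
have e : lmulc 1%g g g o = cmap (ch g) g.
  by rewrite /lmulc cmap_cinv ?mulg1 //; exact: cdom_self.
apply: differentiable_comp.
  by apply: lmulc_diff; rewrite ?mulg1; exact: cdom_self.
rewrite e; apply: rmulc_diff; first exact: cdom_self.
by rewrite mulgV; exact: cdom_self.
Qed.

Lemma conjc_comp_near g h :
  \forall v \near o, conjc (g * h)%g v = (conjc g \o conjc h) v.
Proof.
have m : (h * cinv c1 v * h^-1)%g @[v --> o] --> (1%g : G).
  rewrite -[X in _ --> X](mulgV h) -[X in _ --> (X / _)%g]mulg1.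
  apply: (@mulgG_cvg _ (nbhs o) _ (fun=> h^-1)%g); last exact: cvg_cst.
  apply: (@mulgG_cvg _ (nbhs o) (fun=> h)); first exact: cvg_cst.
  by apply: cinv_cvg; exact: cdom_self.
have hn : \forall v \near o, cdom c1 (h * cinv c1 v * h^-1)%g.
  exact: m _ (nbhs_cdom (cdom_self 1%g)).
near=> v; rewrite /conjc /= [in RHS]cmap_cinv //; last by near: v.
by rewrite invgM !mulgA.
Unshelve. all: by end_near. Qed.

Definition Ad g : 'M[R]_(lgdim G) := 'J (conjc g) o.

(** The order is reversed because Jacobians act on row vectors from the
    right. *)
Lemma AdM g h : Ad (g * h)%g = Ad h *m Ad g.
Proof.
rewrite /Ad; transitivity ('J (conjc g \o conjc h) o).
  apply: near_eq_jacobian; first exact: conjc_comp_near.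
  by apply: differentiable_comp; rewrite ?conjc1; exact: conjc_diff.
rewrite [LHS]jacobian_comp ?conjc1 //; exact: conjc_diff.
Qed.

Lemma Ad1 : Ad 1%g = 1%:M.
Proof.
rewrite /Ad; transitivity ('J (idfun : E -> E) o).
  apply: near_eq_jacobian; last exact: ex_diff.
  have h := nbhs_cimg (cdom_self 1%g).
  by near=> v; rewrite /conjc mul1g invg1 mulg1 cinv_cmap //; near: v.
apply/row_matrixP => i; rewrite row1 rowE mul_jacobian.
exact: (congr1 (fun F => F _) diff_val).
Unshelve. all: by end_near. Qed.

End Adjoint.

(** * First order of the multiplication at the identity *)

Section AdjointNearIdentity.
Variables (R : realType) (G : lieGroup R).
Local Notation E := 'rV[R]_(lgdim G).
Local Notation ch := (lgatlas G).
Local Notation c1 := (ch 1%g).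
Local Notation o := (cmap c1 1%g).
Implicit Types (g h x y : G) (u v w X Y : E).

Local Notation M := (mulc (G := G) 1%g 1%g 1%g).
Local Notation dom := (mulc_dom (G := G) 1%g 1%g 1%g).

(** The differentials at 1 of left and right translation by u, on row
    vectors. *)
Definition Lmx u : 'M[R]_(lgdim G) := 'J (fun v => M (u, v)) o.
Definition Rmx u : 'M[R]_(lgdim G) := 'J (fun w => M (w, u)) o.

Lemma mulc_diff1 x y : cdom c1 x -> cdom c1 y -> cdom c1 (x * y)%g ->
  differentiable (fun w => M (w, cmap c1 y)) (cmap c1 x).
Proof.
move=> x1 y1 xy1.
apply: (@differentiable_comp _ _ _ _ (fun w => (w, cmap c1 y)) M).
  by apply: differentiable_pair; [|exact: differentiable_cst].
exact: mulc_diff.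
Qed.

Lemma mulc_diff2 x y : cdom c1 x -> cdom c1 y -> cdom c1 (x * y)%g ->
  differentiable (fun v => M (cmap c1 x, v)) (cmap c1 y).
Proof.
move=> x1 y1 xy1.
apply: (@differentiable_comp _ _ _ _ (fun v => (cmap c1 x, v)) M).
  by apply: differentiable_pair; [exact: differentiable_cst|].
exact: mulc_diff.
Qed.

(** The identity x v = (x v x^-1) x, differentiated in v at 1: this gives access
    to Ad near 1 through first derivatives of the multiplication in one
    chart. *)
Lemma conjc_Lmx u : cimg c1 u -> Lmx u = Ad (cinv c1 u) *m Rmx u.
Proof.
move=> uc; set x := cinv c1 u.
have x1 : cdom c1 x := cdom_cinv uc.
have ux : u = cmap c1 x by rewrite cinv_cmap.
have e1 := cdom_self (1%g : G).
rewrite /Lmx; transitivity ('J ((fun w => M (w, u)) \o conjc x) o); last first.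
  rewrite [LHS]jacobian_comp; [by rewrite conjc1|exact: conjc_diff|].
  by rewrite conjc1 ux; apply: mulc_diff1; rewrite ?mul1g.
apply: near_eq_jacobian; last first.
  apply: differentiable_comp; first exact: conjc_diff.
  by rewrite conjc1 ux; apply: mulc_diff1; rewrite ?mul1g.
have m : (x * cinv c1 v * x^-1)%g @[v --> o] --> (1%g : G).
  rewrite -[X in _ --> X](mulgV x) -[X in _ --> (X / _)%g]mulg1.
  apply: (@mulgG_cvg _ _ _ (nbhs o) _ (fun=> x^-1)%g); last exact: cvg_cst.
  apply: (@mulgG_cvg _ _ _ (nbhs o) (fun=> x)); first exact: cvg_cst.
  exact: cinv_cvg.
have hn : \forall v \near o, cdom c1 (x * cinv c1 v * x^-1)%g.
  exact: m _ (nbhs_cdom e1).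
near=> v; rewrite /mulc /conjc /= -/x [in RHS]cmap_cinv; last by near: v.
by rewrite mulgVK.
Unshelve. all: by end_near. Qed.

Lemma nbhs_cimg1 : \forall u \near o, cimg c1 u.
Proof. exact: nbhs_cimg (cdom_self _). Qed.

Lemma nbhs_dom : \forall u \near (o, o), dom u.
Proof. by apply: nbhs_mulc_dom; rewrite ?mulg1; exact: cdom_self. Qed.

Lemma nbhs_diag1 (P : set (E * E)) : (\forall z \near (o, o), P z) ->
  \forall u \near o, P (u, o).
Proof.
have h : (u, o) @[u --> o] --> (o, o).
  apply: (@differentiable_continuous _ _ _ o (fun u => (u, o))).
  by apply: differentiable_pair; [|exact: differentiable_cst].
by move=> hP; exact: h.
Qed.

Lemma nbhs_diag2 (P : set (E * E)) : (\forall z \near (o, o), P z) ->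
  \forall u \near o, P (o, u).
Proof.
have h : (o, u) @[u --> o] --> (o, o).
  apply: (@differentiable_continuous _ _ _ o (fun u => (o, u))).
  by apply: differentiable_pair; [exact: differentiable_cst|].
by move=> hP; exact: h.
Qed.

Lemma mulc_o1 u : cimg c1 u -> M (o, u) = u.
Proof. by move=> uc; rewrite /mulc /= cmap_cinv ?mul1g ?cinv_cmap //; exact: cdom_self. Qed.

Lemma mulc_1o u : cimg c1 u -> M (u, o) = u.
Proof. by move=> uc; rewrite /mulc /= [cinv _ o]cmap_cinv ?mulg1 ?cinv_cmap //; exact: cdom_self. Qed.

(** Partial derivatives as directional derivatives on the product, so that
    [schwarz] applies to them. *)
Lemma derive_left (W : normedModType R) (F : E * E -> W) X a b :
  'D_X (fun u => F (u, b)) a = 'D_(X, 0) F (a, b).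
Proof.
have e : (fun h : R => h^-1 *: (((fun u => F (u, b)) \o shift a) (h *: X) - F (a, b)))
    = (fun h : R => h^-1 *: ((F \o shift (a, b)) (h *: ((X, 0) : E * E)) - F (a, b))).
  by apply/funext => h; congr (_ *: (F _ - _)); congr pair; rewrite /= ?scaler0 ?add0r.
by rewrite /derive e.
Qed.

Lemma derive_right (W : normedModType R) (F : E * E -> W) X a b :
  'D_X (fun u => F (a, u)) b = 'D_(0, X) F (a, b).
Proof.
have e : (fun h : R => h^-1 *: (((fun u => F (a, u)) \o shift b) (h *: X) - F (a, b)))
    = (fun h : R => h^-1 *: ((F \o shift (a, b)) (h *: ((0, X) : E * E)) - F (a, b))).
  by apply/funext => h; congr (_ *: (F _ - _)); congr pair; rewrite /= ?scaler0 ?add0r.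
by rewrite /derive e.
Qed.

Lemma left_invariantE X u : left_invariant X u = 'D_(0, X) M (u, o).
Proof. by rewrite -derive_right. Qed.

Lemma D_M_diff (z d : E * E) : dom z -> differentiable ('D_d M) z.
Proof. by have [_ h] := mulc_smooth (G := G) 1%g 1%g 1%g 2; have [h' _] := h d; exact: h'. Qed.

Lemma M_diff (z : E * E) : dom z -> differentiable M z.
Proof. by have [h _] := mulc_smooth (G := G) 1%g 1%g 1%g 1; exact: h. Qed.

Lemma DD_M_cont (z d e : E * E) : dom z -> {for z, continuous ('D_e ('D_d M))}.
Proof.
move=> hz; have [_ h] := mulc_smooth (G := G) 1%g 1%g 1%g 2; have [_ h'] := h d.
by apply: (h' e); exact: mem_set.
Qed.

Lemma LmxE u i j : dom (u, o) -> Lmx u i j = ('D_(0, delta_mx 0 i) M (u, o)) 0 j.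
Proof.
move=> uo; rewrite -derive_right -jacobian_derive ?mxE //.
have [/= uc _ _] := uo.
have := @mulc_diff2 (cinv c1 u) 1%g; rewrite cinv_cmap //; apply.
- exact: cdom_cinv.
- exact: cdom_self.
- by rewrite mulg1; exact: cdom_cinv.
Qed.

Lemma RmxE u i j : dom (o, u) -> Rmx u i j = ('D_(delta_mx 0 i, 0) M (o, u)) 0 j.
Proof.
move=> uo; rewrite -derive_left -jacobian_derive ?mxE //.
have [/= _ uc _] := uo.
have := @mulc_diff1 1%g (cinv c1 u); rewrite cinv_cmap //; apply.
- exact: cdom_self.
- exact: cdom_cinv.
- by rewrite mul1g; exact: cdom_cinv.
Qed.

Lemma jacobian_id (f : E -> E) : (\forall v \near o, f v = v) -> 'J f o = 1%:M.
Proof.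
move=> h; transitivity ('J (idfun : E -> E) o).
  by apply: near_eq_jacobian => //; exact: ex_diff.
apply/row_matrixP => i; rewrite row1 rowE mul_jacobian.
exact: (congr1 (fun F => F _) diff_val).
Qed.

Lemma Lmx_o : Lmx o = 1%:M.
Proof. by apply: jacobian_id; near=> v; apply: mulc_o1; near: v; exact: nbhs_cimg1.
Unshelve. all: by end_near. Qed.

Lemma Rmx_o : Rmx o = 1%:M.
Proof. by apply: jacobian_id; near=> v; apply: mulc_1o; near: v; exact: nbhs_cimg1.
Unshelve. all: by end_near. Qed.

Lemma schwarz_M (d e : E * E) : 'D_e ('D_d M) (o, o) = 'D_d ('D_e M) (o, o).
Proof.
have oo := nbhs_singleton nbhs_dom.
apply/rowP => j.
have coord (F : E * E -> E) (z v : E * E) : differentiable F z ->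
    is_derive z v (fun q => F q 0 j) (('D_v F z) 0 j).
  move=> /diff_derivable dF; have := dF v => dFv; split.
    by move/derivable_mxP : dFv; apply.
  by rewrite (derive_mx dFv) mxE.
have cc d1 d2 : {for (o, o), continuous (fun q => ('D_d1 ('D_d2 M) q) 0 j)}.
  have h := @DD_M_cont (o, o) d2 d1 oo.
  exact: (continuous_comp h (@coord_continuous _ _ _ _ _ _)).
apply: (@schwarz _ _ (fun q => M q 0 j) (fun q => ('D_d M q) 0 j)
  (fun q => ('D_e M q) 0 j) (fun q => ('D_e ('D_d M) q) 0 j)
  (fun q => ('D_d ('D_e M) q) 0 j) (o, o) d e).
- by near=> z; apply: coord; apply: M_diff; near: z; exact: nbhs_dom.
- by near=> z; apply: coord; apply: M_diff; near: z; exact: nbhs_dom.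
- by near=> z; apply: coord; apply: D_M_diff; near: z; exact: nbhs_dom.
- by near=> z; apply: coord; apply: D_M_diff; near: z; exact: nbhs_dom.
- exact: cc.
- exact: cc.
Unshelve. all: by end_near. Qed.

(** In the bracket of left-invariant fields the term D_Y (D_(0, X) M) at (o, o)
    is a mixed derivative; exchanging it makes both terms derivatives along the
    same X, that is, the first-order difference of [Lmx] and [Rmx]. *)
Lemma tangent_bracketE X Y : tangent_bracket X Y =
  'D_X (fun u => 'D_(0, Y) M (u, o)) o - 'D_X (fun u => 'D_(Y, 0) M (o, u)) o.
Proof.
have lo Z : left_invariant Z o = Z.
  rewrite left_invariantE -derive_right -[RHS](@derive_id _ _ o).
  by apply: near_eq_derive; near=> v; apply: mulc_o1; near: v; exact: nbhs_cimg1.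
rewrite /tangent_bracket /vector_field_bracket !lo.
have e Z : left_invariant Z = (fun u => 'D_(0, Z) M (u, o)).
  by apply/funext => u; rewrite left_invariantE.
rewrite (e X) (e Y).
have sw : 'D_Y (fun u => 'D_(0, X) M (u, o)) o = 'D_X (fun u => 'D_(Y, 0) M (o, u)) o.
  rewrite (derive_left ('D_(0, X) M)) schwarz_M.
  by rewrite -(derive_right ('D_(Y, 0) M)).
exact: (congr1 (fun z => 'D_X (fun u => 'D_(0, Y) M (u, o)) o - z) sw).
Unshelve. all: by end_near. Qed.

Lemma D_M_left_diff (d : E * E) : differentiable (fun u => 'D_d M (u, o)) o.
Proof.
apply: (@differentiable_comp _ _ _ _ (fun u => (u, o)) ('D_d M)).
  by apply: differentiable_pair; [|exact: differentiable_cst].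
by apply: D_M_diff; exact: nbhs_singleton nbhs_dom.
Qed.

Lemma D_M_right_diff (d : E * E) : differentiable (fun u => 'D_d M (o, u)) o.
Proof.
apply: (@differentiable_comp _ _ _ _ (fun u => (o, u)) ('D_d M)).
  by apply: differentiable_pair; [exact: differentiable_cst|].
by apply: D_M_diff; exact: nbhs_singleton nbhs_dom.
Qed.

Lemma coord_cvg (T : Type) (F : set_system T) (f : T -> E) (l : E) j :
  f @ F --> l -> (f t) 0 j @[t --> F] --> l 0 j.
Proof. move=> h; exact: (cvg_comp _ _ h (@coord_continuous _ _ _ 0 j l)). Qed.

Lemma Lmx_cvg : mcvg (nbhs o) Lmx 1%:M.
Proof.
move=> i j; rewrite -Lmx_o.
have near_e : \forall u \near o, ('D_(0, delta_mx 0 i) M (u, o)) 0 j = Lmx u i j.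
  near=> u; rewrite LmxE //; near: u; exact: nbhs_diag1 nbhs_dom.
apply: cvg_trans (near_eq_cvg near_e) _.
rewrite LmxE; last exact: nbhs_singleton nbhs_dom.
exact: coord_cvg (differentiable_continuous (D_M_left_diff _)).
Unshelve. all: by end_near. Qed.

Lemma Rmx_cvg : mcvg (nbhs o) Rmx 1%:M.
Proof.
move=> i j; rewrite -Rmx_o.
have near_e : \forall u \near o, ('D_(delta_mx 0 i, 0) M (o, u)) 0 j = Rmx u i j.
  near=> u; rewrite RmxE //; near: u; exact: nbhs_diag2 nbhs_dom.
apply: cvg_trans (near_eq_cvg near_e) _.
rewrite RmxE; last exact: nbhs_singleton nbhs_dom.
exact: coord_cvg (differentiable_continuous (D_M_right_diff _)).
Unshelve. all: by end_near. Qed.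

Lemma Ad_near : \forall u \near o,
  Rmx u \in unitmx /\ Ad (cinv c1 u) = Lmx u *m invmx (Rmx u).
Proof.
have [un _] := mcvg_inv (unitmx1 _ _) Rmx_cvg.
near=> u; have ru : Rmx u \in unitmx by near: u.
split=> //; rewrite conjc_Lmx ?mulmxK //; near: u; exact: nbhs_cimg1.
Unshelve. all: by end_near. Qed.

Lemma Ad_cvg1 : mcvg (nbhs o) (fun u => Ad (cinv c1 u)) 1%:M.
Proof.
have [_ inv] := mcvg_inv (unitmx1 _ _) Rmx_cvg.
have := mcvgM Lmx_cvg inv; rewrite invmx1 mulmx1 => h i j.
have near_e : \forall u \near o, (Lmx u *m invmx (Rmx u)) i j = Ad (cinv c1 u) i j.
  by near=> u; have [_ ->] : Rmx u \in unitmx /\ Ad (cinv c1 u) = Lmx u *m invmx (Rmx u)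
    by near: u; exact: Ad_near.
by apply: cvg_trans (near_eq_cvg near_e) _; exact: h.
Unshelve. all: by end_near. Qed.

End AdjointNearIdentity.

(** * Derivative and boundedness of the adjoint representation *)

Lemma cvg_preimage (T : Type) (U : topologicalType) (F : set_system T)
    (f : T -> U) (y : U) (P : set U) :
  f @ F --> y -> nbhs y P -> F (f @^-1` P).
Proof. by move=> fy Py; exact: fy. Qed.

Section AdjointBounded.
Variables (R : realType) (G : lieGroup R).
Local Notation n := (lgdim G).
Local Notation E := 'rV[R]_n.
Local Notation ch := (lgatlas G).
Local Notation c1 := (ch 1%g).
Local Notation o := (cmap c1 1%g).
Implicit Types (g h x y : G) (u v w X Y : E).

Local Notation M := (mulc (G := G) 1%g 1%g 1%g).

Lemma quotient_entry (t l r : R) (a b c e : E) j :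
  a 0 j = l -> c 0 j = r -> b 0 j = e 0 j ->
  (t^-1 *: (a - b) - t^-1 *: (c - e)) 0 j = t^-1 * (l - r).
Proof. by move=> <- <- be; rewrite !mxE be; ring. Qed.

Lemma quotient_inv (t : R) (A B : 'M[R]_n) : B \in unitmx ->
  (t^-1 *: (A - B)) *m invmx B = t^-1 *: (A *m invmx B - 1%:M).
Proof. by move=> uB; rewrite -scalemxAl mulmxBl mulmxV. Qed.

(** Ad = Lmx Rmx^-1 near 1, hence Ad - 1 = (Lmx - Rmx) Rmx^-1. The first factor
    vanishes at o and its derivative at o along X is Y |-> [X, Y] by
    [tangent_bracketE], while Rmx tends to 1. *)
Lemma Ad_derive X (B : 'M[R]_n) :
  (forall i, row i B = tangent_bracket X (delta_mx 0 i)) ->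
  mcvg (0^') (fun t : R => t^-1 *: (Ad (cinv c1 (t *: X + o)) - 1%:M)) B.
Proof.
move=> rowB.
have uo : t *: X + o @[t --> (0 : R)^'] --> o.
  have -> : nbhs o = nbhs ((0 : R) *: X + o) by rewrite scale0r add0r.
  apply: cvgD; last exact: cvg_cst.
  by apply: cvgZr_tmp; apply: cvg_within_filter; exact: cvg_id.
have [_ inv] := mcvg_inv (unitmx1 _ _) (@Rmx_cvg _ G).
have inv' : mcvg (0 : R)^' (fun t => invmx (Rmx (t *: X + o))) 1%:M.
  by move=> i j; have := inv i j; rewrite invmx1 => h; exact: (cvg_comp _ _ uo h).
have quot (f : E -> E) : differentiable f o ->
    t^-1 *: (f (t *: X + o) - f o) @[t --> (0 : R)^'] --> 'D_X f o.
  by move=> df; exact: (diff_derivable (v := X) df).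
have e2 i j : Lmx (G := G) o i j = Rmx o i j by rewrite Lmx_o Rmx_o.
have oo := nbhs_singleton (@nbhs_dom _ G).
have main : mcvg (0 : R)^'
    (fun t => t^-1 *: (Lmx (t *: X + o) - Rmx (t *: X + o))) B.
  move=> i j.
  have hL := quot _ (D_M_left_diff (G := G) (0, delta_mx 0 i)).
  have hR := quot _ (D_M_right_diff (G := G) (delta_mx 0 i, 0)).
  have eB : ('D_X (fun u => 'D_(0, delta_mx 0 i) M (u, o)) o -
      'D_X (fun u => 'D_(delta_mx 0 i, 0) M (o, u)) o) 0 j = B i j.
    rewrite -(tangent_bracketE X (delta_mx 0 i)).
    by have := congr1 (fun r : E => r 0 j) (rowB i); rewrite mxE.
  have := coord_cvg (j := j) (cvgB hL hR); rewrite [X in _ --> X]eB => h.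
  have near_e : \forall t \near (0 : R)^',
    ((t^-1 *: ('D_(0, delta_mx 0 i) M (t *: X + o, o) - 'D_(0, delta_mx 0 i) M (o, o)))
     - (t^-1 *: ('D_(delta_mx 0 i, 0) M (o, t *: X + o) - 'D_(delta_mx 0 i, 0) M (o, o)))) 0 j
    = (t^-1 *: (Lmx (t *: X + o) - Rmx (t *: X + o))) i j.
    have n1 : \forall t \near (0 : R)^', mulc_dom (G := G) 1%g 1%g 1%g (t *: X + o, o).
      exact: uo _ (nbhs_diag1 (@nbhs_dom _ G)).
    have n2 : \forall t \near (0 : R)^', mulc_dom (G := G) 1%g 1%g 1%g (o, t *: X + o).
      exact: uo _ (nbhs_diag2 (@nbhs_dom _ G)).
    near=> t; rewrite [RHS]mxE [X in _ = _ * X]mxE [X in _ = _ * (_ + X)]mxE.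
    have d1 : mulc_dom (G := G) 1%g 1%g 1%g (t *: X + o, o) by near: t.
    have d2 : mulc_dom (G := G) 1%g 1%g 1%g (o, t *: X + o) by near: t.
    apply: quotient_entry.
    - exact: esym (LmxE i j d1).
    - exact: esym (RmxE i j d2).
    - exact: etrans (esym (LmxE i j oo)) (etrans (e2 i j) (RmxE i j oo)).
  by apply: cvg_trans (near_eq_cvg near_e) _; exact: h.
have := mcvgM main inv'; rewrite mulmx1 => h i j.
have nA : \forall t \near (0 : R)^', Rmx (t *: X + o) \in unitmx /\
    Ad (cinv c1 (t *: X + o)) = Lmx (t *: X + o) *m invmx (Rmx (t *: X + o)).
  exact: uo _ (@Ad_near _ G).
have near_e : \forall t \near (0 : R)^',
  ((t^-1 *: (Lmx (t *: X + o) - Rmx (t *: X + o))) *m invmx (Rmx (t *: X + o))) i j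
  = (t^-1 *: (Ad (cinv c1 (t *: X + o)) - 1%:M)) i j.
  near=> t.
  have [ru ->] : Rmx (t *: X + o) \in unitmx /\
    Ad (cinv c1 (t *: X + o)) = Lmx (t *: X + o) *m invmx (Rmx (t *: X + o)).
    by near: t.
  exact: (congr1 (fun A : 'M[R]_n => A i j) (quotient_inv _ _ ru)).
by apply: cvg_trans (near_eq_cvg near_e) _; exact: h.
Unshelve. all: by end_near. Qed.

Lemma Ad_bounded_near1 : \forall g \near (1%g : G), forall i j, `|Ad g i j| <= 2.
Proof.
have h : \forall u \near o, forall i j, `|Ad (cinv c1 u) i j| <= 2.
  apply: (@filter_forall _ _ _ (nbhs o)) => i; apply: (@filter_forall _ _ _ (nbhs o)) => j.
  have /cvgrPdist_le/(_ 1 ltr01) hij := @Ad_cvg1 _ G i j.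
  near=> u.
  have : `|(1%:M : 'M[R]_n) i j - Ad (cinv c1 u) i j| <= 1 by near: u.
  rewrite mxE distrC => hu; rewrite -[X in `|X|](subrK (i == j)%:R).
  rewrite (le_trans (ler_normD _ _)) // (_ : 2 = 1 + 1) //; apply: lerD => //.
  by rewrite normr_nat; case: (i == j).
have c := cmap_cvg (cdom_self (1%g : G)).
have h1 : \forall g \near (1%g : G), forall i j, `|Ad (cinv c1 (cmap c1 g)) i j| <= 2.
  exact: c _ h.
have h2 := nbhs_cdom (cdom_self (1%g : G)).
by apply: filterS2 h1 h2 => g hg gd i j; rewrite -(cmap_cinv gd).
Unshelve. all: by end_near. Qed.

(** Ad is bounded near 1, hence near each p, as Ad g = Ad p *m Ad (g p^-1);
    compactness makes the bound uniform. *)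
Lemma Ad_bounded : compact [set: G] ->
  exists C : R, forall g i j, `|Ad g i j| <= C.
Proof.
move=> /compact_near_coveringP cG.
have h : \forall C \near +oo%R,
    [set: G] `<=` (fun g => forall i j, `|Ad g i j| <= C).
  apply: (cG R (pinfty_nbhs R) (fun C g => forall i j, `|Ad g i j| <= C)) => p _.
  pose K := \sum_i \sum_j `|Ad p i j|.
  have Kp i j : `|Ad p i j| <= K.
    rewrite /K (bigD1 i) //= (bigD1 j) //= -addrA lerDl addr_ge0 ?sumr_ge0 //.
    by move=> k _; exact: sumr_ge0.
  pose small : set G := [set h | forall i j, `|Ad h i j| <= 2].
  have near1 : nbhs p ((fun g : G => (g * p^-1)%g) @^-1` small).
    apply: (@cvg_preimage G G (nbhs p) _ (p * p^-1)%g).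
      by apply: (@mulgG_cvg _ _ _ (nbhs p) id (fun=> p^-1)%g); [exact: cvg_id|exact: cvg_cst].
    by rewrite mulgV; exact: Ad_bounded_near1.
  have bd g : small (g * p^-1)%g ->
      forall i j, `|Ad g i j| <= n%:R * (K * 2).
    move=> hg i j.
    have -> : Ad g = Ad p *m Ad (g * p^-1)%g by rewrite -AdM mulgVK.
    rewrite mxE.
    apply: (le_trans (ler_norm_sum _ _ _)).
    have -> : n%:R * (K * 2) = \sum_(k < n) (K * 2).
      by rewrite sumr_const card_ord mulr_natl.
    apply: ler_sum => k _; rewrite normrM.
    exact: ler_pM (normr_ge0 _) (normr_ge0 _) (Kp _ _) (hg _ _).
  exists ((fun g => (g * p^-1)%g) @^-1` small, [set C | n%:R * (K * 2) <= C]).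
    by split; [exact: near1|apply: nbhs_pinfty_ge; exact: num_real].
  by move=> [g C] /= [hg hC] i j; rewrite (le_trans (bd _ hg _ _)).
near (+oo%R : set_system R) => C.
exists C => g; have hC : [set: G] `<=` (fun g => forall i j, `|Ad g i j| <= C) by near: C.
exact: hC.
Unshelve. all: by end_near. Qed.

End AdjointBounded.

(** * Matrices with bounded powers *)

Section PositiveDefinite.
Variable R : realType.

Definition posdef n (Q : 'M[R]_n) :=
  forall v : 'rV[R]_n, v != 0 -> 0 < (v *m Q *m v^T) 0 0.

(** Induction on the size by elimination of the first variable: the Schur
    complement of the top left entry is again positive definite. *)
Lemma cholesky n (Q : 'M[R]_n) : Q^T = Q -> posdef Q ->
  exists2 P : 'M[R]_n, P \in unitmx & Q = P *m P^T.
Proof.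
elim: n Q => [|n IH] Q symQ pdQ.
  by exists 1%:M; [exact: unitmx1|rewrite [LHS]flatmx0 [RHS]flatmx0].
move: Q symQ pdQ; rewrite -[n.+1]/(1 + n)%N => Q symQ pdQ.
pose q : R := Q 0 0.
pose r : 'M[R]_(1, n) := ursubmx Q.
pose Q' : 'M[R]_n := drsubmx Q.
have QE : Q = block_mx q%:M r r^T Q'.
  rewrite -[LHS]submxK; congr block_mx.
    by rewrite [LHS]mx11_scalar !mxE /q; congr (Q _ _)%:M; apply/val_inj.
  by rewrite /r trmx_ursub symQ.
have q0 : 0 < q.
  have := pdQ (delta_mx 0 0); rewrite -rowE trmx_delta -colE !mxE; apply.
  by apply/negP => /eqP/matrixP/(_ 0 0)/eqP; rewrite !mxE !eqxx oner_eq0.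
pose S := Q' - q^-1 *: (r^T *m r).
have symS : S^T = S.
  rewrite /S linearB linearZ /= trmx_mul trmxK; congr (_ - _).
  by rewrite /Q' trmx_drsub symQ.
have pdS : posdef S.
  (* this vector minimizes the form of Q among those that end with w *)
  move=> w w0; have := pdQ (row_mx (- q^-1 *: (w *m r^T)) w).
  rewrite QE mul_row_block tr_row_mx mul_row_col.
  rewrite mul_mx_scalar scalerA mulrN mulfV ?gt_eqF // scaleN1r addNr mul0mx add0r.
  rewrite -scalemxAl scaleNr addrC.
  rewrite (_ : w *m Q' + _ = w *m S); last first.
    by rewrite /S mulmxBr -scalemxAr mulmxA scaleNr.
  apply; apply: contra w0 => /eqP h; apply/eqP.
  by have := congr1 rsubmx h; rewrite row_mxKr linear0.
have [P' uP' SE] := IH S symS pdS.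
pose s := Num.sqrt q.
have s0 : 0 < s by rewrite sqrtr_gt0.
have ss : s * s = q by rewrite -expr2 sqr_sqrtr // ltW.
exists (block_mx s%:M 0 (s^-1 *: r^T) P').
  rewrite unitmxE det_lblock unitrM -!unitmxE uP' andbT unitmxE det_scalar unitfE.
  by rewrite expf_neq0 // gt_eqF.
rewrite tr_block_mx mulmx_block !tr_scalar_mx !trmx0 ?mul0mx ?mulmx0 ?addr0.
rewrite -SE QE; congr block_mx.
- by rewrite -scalar_mxM ss.
- by rewrite mul_scalar_mx linearZ /= trmxK scalerA mulfV ?gt_eqF // scale1r.
- by rewrite mul_mx_scalar scalerA mulfV ?gt_eqF // scale1r.
rewrite linearZ /= trmxK -scalemxAl -scalemxAr scalerA -invfM ss /S addrC subrK //.
Qed.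

(** In the basis given by a square root P of Q the matrix A becomes skew
    symmetric, and the trace of its square is minus the sum of the squares of
    its entries. *)
Lemma skew_trace_sq n (A Q : 'M[R]_n) :
  Q^T = Q -> posdef Q -> A *m Q + Q *m A^T = 0 ->
  \tr (A *m A) <= 0 /\ (\tr (A *m A) = 0 -> A = 0).
Proof.
move=> symQ pdQ AQ; have [P uP QE] := cholesky symQ pdQ.
pose A' := invmx P *m A *m P.
have uPt : P^T \in unitmx by rewrite unitmx_tr.
have skew : A' = - A'^T.
  have : invmx P *m (A *m Q + Q *m A^T) *m invmx P^T = 0.
    by rewrite AQ mulmx0 mul0mx.
  rewrite mulmxDr mulmxDl QE.
  rewrite !mulmxA mulmxK // mulVmx // mul1mx -/A' => /eqP.
  rewrite addr_eq0 => /eqP E; rewrite [LHS]E; congr (- _).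
  by rewrite /A' !trmx_mul trmx_inv mulmxA.
have trE : \tr (A *m A) = - \sum_i \sum_j A' i j ^+ 2.
  have -> : \tr (A *m A) = \tr (A' *m A').
    rewrite /A' -!mulmxA mulKVmx // [RHS]mxtrace_mulC !mulmxA mulmxK //.
  have -> : \tr (A' *m A') = \tr (A' *m (- A'^T)) by rewrite -skew.
  rewrite mulmxN linearN /=; congr (- _).
  rewrite /mxtrace; apply: eq_bigr => i _; rewrite mxE; apply: eq_bigr => j _.
  by rewrite [A'^T _ _]mxE expr2.
have ge : forall i, true -> 0 <= \sum_j A' i j ^+ 2.
  by move=> i _; apply: sumr_ge0 => j _; exact: sqr_ge0.
rewrite trE; split; first by rewrite oppr_le0 sumr_ge0.
move/eqP; rewrite oppr_eq0 psumr_eq0 // => /allP h.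
have A'0 : A' = 0.
  apply/matrixP => i j; rewrite [RHS]mxE; have := h i; rewrite mem_index_enum => /(_ isT).
  rewrite psumr_eq0; last by move=> ? _; exact: sqr_ge0.
  move=> /allP/(_ j); rewrite mem_index_enum => /(_ isT).
  by rewrite sqrf_eq0 => /eqP.
have -> : A = P *m A' *m invmx P by rewrite /A' !mulmxA mulmxV // mul1mx mulmxK.
by rewrite A'0 mulmx0 mul0mx.
Qed.

End PositiveDefinite.

Section BoundedPowers.
Variable R : realType.

(** Limits along an ultrafilter replace successive extractions of
    subsequences. *)
Lemma ultra_bounded_cvg (U : set_system nat) (x : nat -> R) (C : R) :
  UltraFilter U -> (forall k, `|x k| <= C) -> exists l : R, x k @[k --> U] --> l.
Proof.
move=> UU xC.
have cK := @segment_compact R (- C) C.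
have FK : (x k @[k --> U]) `[- C, C]%classic.
  apply: (@filterS _ U _ setT) => [k _ /=|]; last exact: filterT.
  by rewrite in_itv /= -ler_norml.
have [l [_ cl]] := cK _ (fmap_proper_filter x _) FK.
exists l => V Vl.
have [//|nV] := in_ultra_setVsetC (x @^-1` V) UU.
have : (x k @[k --> U]) (~` V) by [].
by move=> /cl /(_ Vl) [y [? ?]].
Qed.

Lemma ultra_bounded_mcvg n (U : set_system nat) (x : nat -> 'M[R]_n) (C : R) :
  UltraFilter U -> (forall k i j, `|x k i j| <= C) -> exists l, mcvg U x l.
Proof.
move=> UU xC.
pose l i j := projT1 (cid (ultra_bounded_cvg UU (fun k => xC k i j))).
exists (\matrix_(i, j) l i j) => i j; rewrite mxE.
exact: projT2 (cid (ultra_bounded_cvg UU (fun k => xC k i j))).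
Qed.

Lemma mcvg_unique n (T : Type) (F : set_system T) (x : T -> 'M[R]_n) a b :
  ProperFilter F -> mcvg F x a -> mcvg F x b -> a = b.
Proof.
move=> FF xa xb; apply/matrixP => i j.
exact: (@cvg_unique _ (@norm_hausdorff _ _) _ _ _ _ (xa i j) (xb i j)).
Qed.

Definition sqn n (v : 'rV[R]_n) : R := \sum_i v 0 i ^+ 2.

Lemma sqnE n (v : 'rV[R]_n) : sqn v = (v *m v^T) 0 0.
Proof. by rewrite mxE; apply: eq_bigr => i _; rewrite mxE expr2. Qed.

Lemma sqn_ge0 n (v : 'rV[R]_n) : 0 <= sqn v.
Proof. by apply: sumr_ge0 => i _; exact: sqr_ge0. Qed.

Lemma sqn_gt0 n (v : 'rV[R]_n) : v != 0 -> 0 < sqn v.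
Proof.
move=> v0; rewrite lt0r sqn_ge0 andbT; apply: contra v0.
rewrite psumr_eq0 => [/allP h|i _]; last exact: sqr_ge0.
apply/eqP/rowP => i; rewrite mxE; have := h i; rewrite mem_index_enum => /(_ isT).
by rewrite sqrf_eq0 => /eqP.
Qed.

(** A crude operator norm bound from a bound on the entries. *)
Lemma sqn_mul_le n (B : 'M[R]_n) (C : R) (v : 'rV[R]_n) :
  (forall i j, `|B i j| <= C) -> sqn (v *m B) <= (n%:R * C) ^+ 2 * sqn v.
Proof.
move=> BC.
have step j : ((v *m B) 0 j) ^+ 2 <= n%:R * C ^+ 2 * sqn v.
  rewrite mxE expr2 big_distrlr /=.
  have -> : n%:R * C ^+ 2 * sqn v = \sum_i \sum_k C ^+ 2 * ((v 0 i ^+ 2 + v 0 k ^+ 2) / 2).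
    transitivity (C ^+ 2 * (\sum_(i < n) \sum_(k < n) v 0 i ^+ 2 / 2
        + \sum_(i < n) \sum_(k < n) v 0 k ^+ 2 / 2)).
      rewrite exchange_big /= -mulr2n (eq_bigr (fun=> sqn v / 2)); last first.
        by move=> i _; rewrite -mulr_suml.
      rewrite sumr_const card_ord -mulrnA.
      rewrite -[X in C ^+ 2 * X]mulr_natr natrM; by field.
    rewrite -big_split mulr_sumr /=; apply: eq_bigr => i _.
    rewrite -[RHS]mulr_sumr; congr (_ * _); rewrite -big_split /=; apply: eq_bigr => k _; by field.
  apply: ler_sum => i _; apply: ler_sum => k _.
  have Bi := BC i j; have Bk := BC k j.
  have h : `|v 0 i * B i j * (v 0 k * B k j)| <= C ^+ 2 * (`|v 0 i| * `|v 0 k|).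
    rewrite !normrM [X in X <= _](_ : _ = (`|B i j| * `|B k j|) * (`|v 0 i| * `|v 0 k|)); last by ring.
    by rewrite ler_wpM2r ?mulr_ge0 // expr2 ler_pM.
  apply: le_trans (le_trans (ler_norm _) h) _; rewrite ler_wpM2l ?sqr_ge0 //.
  rewrite -[v 0 i ^+ 2]real_normK ?num_real // -[v 0 k ^+ 2]real_normK ?num_real //.
  have := sqr_ge0 (`|v 0 i| - `|v 0 k|); nra.
rewrite /sqn (le_trans (ler_sum _ (fun j _ => step j))) //.
rewrite sumr_const card_ord -mulr_natl le_eqVlt; apply/orP; left; apply/eqP; rewrite /sqn; ring.
Qed.

(** The average over the powers of B of the forms v |-> |v B^j|^2. *)
Definition gram n (B : 'M[R]_n) (N : nat) : 'M[R]_n :=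
  N%:R^-1 *: \sum_(j < N) (B ^+ j) *m (B ^+ j)^T.

Lemma gram_sym n (B : 'M[R]_n) N : (gram B N)^T = gram B N.
Proof.
rewrite /gram linearZ /= linear_sum /=; congr (_ *: _).
by apply: eq_bigr => j _; rewrite trmx_mul trmxK.
Qed.

(** The sum telescopes: the defect of invariance under B is of order 1/N. *)
Lemma gram_shift n (B : 'M[R]_n) N :
  B *m gram B N *m B^T - gram B N = N%:R^-1 *: (B ^+ N *m (B ^+ N)^T - 1%:M).
Proof.
rewrite /gram -scalemxAr -scalemxAl -scalerBr; congr (_ *: _).
have -> : B *m (\sum_(j < N) (B ^+ j) *m (B ^+ j)^T) *m B^T =
    \sum_(j < N) (B ^+ j.+1) *m (B ^+ j.+1)^T.
  rewrite mulmx_sumr mulmx_suml; apply: eq_bigr => j _.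
  by rewrite exprS -mulmxE trmx_mul !mulmxA.
apply/eqP; rewrite subr_eq addrAC -subr_eq opprK addrC; apply/eqP.
rewrite -(big_ord_recr N (fun j => (B ^+ j) *m (B ^+ j)^T)) /= big_ord_recl /= expr0.
by rewrite trmx1 mul1mx addrC.
Qed.

Lemma gram_form n (B : 'M[R]_n) N v :
  (v *m gram B N *m v^T) 0 0 = N%:R^-1 * \sum_(j < N) sqn (v *m B ^+ j).
Proof.
rewrite /gram -scalemxAr -scalemxAl mxE; congr (_ * _).
rewrite mulmx_sumr mulmx_suml summxE; apply: eq_bigr => j _.
by rewrite sqnE trmx_mul !mulmxA.
Qed.

Lemma mulmx_entry_le n (A B : 'M[R]_n) a b :
  (forall i j, `|A i j| <= a) -> (forall i j, `|B i j| <= b) ->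
  forall i j, `|(A *m B) i j| <= n%:R * (a * b).
Proof.
move=> hA hB i j; rewrite mxE; apply: (le_trans (ler_norm_sum _ _ _)).
have -> : n%:R * (a * b) = \sum_(k < n) (a * b).
  by rewrite sumr_const card_ord mulr_natl.
by apply: ler_sum => k _; rewrite normrM ler_pM.
Qed.

Lemma gram_entry_le n (B : 'M[R]_n) N C :
  (forall k i j, `|(B ^+ k) i j| <= C) ->
  forall i j, `|gram B N.+1 i j| <= n%:R * (C * C).
Proof.
move=> BC i j; rewrite mxE normrM summxE ger0_norm ?invr_ge0 ?ler0n //.
rewrite mulrC ler_pdivrMr ?ltr0n //; apply: (le_trans (ler_norm_sum _ _ _)).
have -> : n%:R * (C * C) * N.+1%:R = \sum_(k < N.+1) (n%:R * (C * C)).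
  by rewrite sumr_const card_ord mulr_natr.
apply: ler_sum => k _; apply: mulmx_entry_le => // a b; rewrite mxE; exact: BC.
Qed.

(** A is the generator of the almost one-parameter family B_k = 1 + A/k + o(1/k).
    Average over N = k^2 powers of B_k: then the defect of invariance, of order
    1/N, is negligible against the first-order term, of order 1/k, and the
    limit of the relation B_k Q_k B_k^T - Q_k = O(1/N), multiplied by k, is
    A Q + Q A^T = 0. The limit Q is positive definite since |v| is bounded by a
    multiple of |v B_k^j|, uniformly in j and k, by the bound on the powers of
    the inverse Bi_k. *)
Lemma bounded_powers_skew n (A : 'M[R]_n) (B Bi : nat -> 'M[R]_n) (C : R) :
  (forall k, B k *m Bi k = 1%:M) ->
  (forall k m i j, `|(B k ^+ m) i j| <= C) ->
  (forall k m i j, `|(Bi k ^+ m) i j| <= C) ->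
  mcvg \oo (fun k => k.+1%:R *: (B k - 1%:M)) A ->
  exists Q, [/\ Q^T = Q, posdef Q & A *m Q + Q *m A^T = 0].
Proof.
move=> BBi BC BiC BA.
have [U [UU Uoo]] := ultraFilterLemma (@eventually_filter).
pose N k := (k.+1 * k.+1)%N.
have NS k : N k = (N k).-1.+1 by rewrite prednK // muln_gt0.
pose Qs k := gram (B k) (N k).
have QC k i j : `|Qs k i j| <= n%:R * (C * C).
  by rewrite /Qs NS; apply: gram_entry_le; exact: BC.
have [Q QQ] := ultra_bounded_mcvg UU QC.
have PU : ProperFilter U by exact: ultra_proper.
exists Q; split.
- apply: (mcvg_unique PU (mcvg_tr QQ)) => i j.
  by under eq_fun do rewrite gram_sym; exact: QQ.
(* adding 1 keeps K positive when n or C is 0 *)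
- move=> v v0; pose K := (n%:R * C) ^+ 2 + 1.
  have K0 : 0 < K by rewrite ltr_wpDl ?sqr_ge0.
  have lower k : K^-1 * sqn v <= (v *m Qs k *m v^T) 0 0.
    rewrite gram_form ler_pdivrMl // mulrCA ler_pdivlMl; last by rewrite ltr0n NS.
    rewrite [leRHS]mulr_sumr [leLHS](_ : _ = \sum_(j < N k) sqn v); last first.
      by rewrite sumr_const card_ord mulr_natl.
    apply: ler_sum => j _.
    have e : v = v *m B k ^+ j *m Bi k ^+ j.
      rewrite -mulmxA; suff -> : B k ^+ j *m Bi k ^+ j = 1%:M by rewrite mulmx1.
      elim: (nat_of_ord j) => [|m IH]; first by rewrite !expr0 mulmx1.
      by rewrite exprSr exprS -!mulmxE -!mulmxA (mulmxA (B k)) BBi mul1mx.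
    rewrite {1}e (le_trans (sqn_mul_le _ (BiC k j))) // ler_wpM2r ?sqn_ge0 //.
    by rewrite lerDl.
  have lim : (v *m Qs k *m v^T) 0 0 @[k --> U] --> (v *m Q *m v^T) 0 0.
    have h : mcvg U (fun k => v *m Qs k *m v^T) (v *m Q *m v^T).
      by apply: mcvgM; [apply: mcvgM; [exact: mcvg_cst|]|exact: mcvg_cst].
    exact: h.
  apply: (@lt_le_trans _ _ (K^-1 * sqn v)).
    by rewrite mulr_gt0 ?invr_gt0 // sqn_gt0.
  apply: (ler_cvg_to (cvg_cst _) lim).
  by apply: nearW => k; exact: lower.
pose Ak k := k.+1%:R *: (B k - 1%:M).
have sub (f : nat -> R) (l : R) : f k @[k --> \oo] --> l -> f k @[k --> U] --> l.
  by move=> fl V /fl; exact: Uoo.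
have AU : mcvg U Ak A by move=> i j; apply: sub; exact: BA.
have h0 : k.+1%:R^-1 @[k --> U] --> (0 : R) by apply: sub; exact: cvg_harmonic.
have mcvgZ (f : nat -> R) (l : R) (X : nat -> 'M[R]_n) Y : f k @[k --> U] --> l ->
    mcvg U X Y -> mcvg U (fun k => f k *: X k) (l *: Y).
  move=> fl XY i j; rewrite mxE; under eq_fun do rewrite mxE.
  by apply: cvgM => //; exact: XY.
have lim1 : mcvg U (fun k => Ak k *m Qs k + Qs k *m (Ak k)^T +
    k.+1%:R^-1 *: (Ak k *m Qs k *m (Ak k)^T))
    (A *m Q + Q *m A^T + 0 *: (A *m Q *m A^T)).
  have AUt := mcvg_tr AU.
  apply: mcvgD; first by apply: mcvgD; apply: mcvgM.
  by apply: mcvgZ => //; apply: mcvgM => //; apply: mcvgM.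
rewrite scale0r addr0 in lim1; apply: (mcvg_unique PU lim1).
(* E_k / k tends to 0, and it equals the expression whose limit is lim1 *)
pose E k := (B k ^+ N k *m (B k ^+ N k)^T - 1%:M).
have EC k i j : `|E k i j| <= n%:R * (C * C) + 1.
  rewrite /E mxE (le_trans (ler_normD _ _)) // lerD //.
    by apply: mulmx_entry_le => a b; [|rewrite mxE]; exact: BC.
  by rewrite !mxE normrN normr_nat lern1; case: (i == j).
have [L EL] := ultra_bounded_mcvg UU EC.
have lim2 := mcvgZ _ _ _ _ h0 EL; rewrite scale0r in lim2.
move=> i j; have := lim2 i j; apply: cvg_trans; apply: near_eq_cvg.
apply: nearW => k; congr (fun_of_matrix _ i j).
have k0 : k.+1%:R != 0 :> R by rewrite pnatr_eq0.
have -> : k.+1%:R^-1 *: E k = k.+1%:R *: (B k *m Qs k *m (B k)^T - Qs k).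
  rewrite gram_shift scalerA -/(E k); congr (_ *: _).
  by rewrite /N natrM invfM mulrA mulfV // mul1r.
have -> : B k = 1%:M + k.+1%:R^-1 *: Ak k.
  by rewrite /Ak scalerA mulVf // scale1r addrC subrK.
move: (Qs k) (Ak k) k0 => q x k0.
have -> : (1%:M + k.+1%:R^-1 *: x)^T = 1%:M + k.+1%:R^-1 *: x^T.
  by rewrite linearD linearZ /= trmx1.
rewrite !mulmxDl !mulmxDr !mul1mx !mulmx1 -!scalemxAl -!scalemxAr.
rewrite addrAC [q + _ - q]addrAC subrr add0r -!scalerDr scalerA mulfV // scale1r.
by rewrite addrCA addrA.
Qed.

End BoundedPowers.

(** * Brackets and the Killing form *)

Section LieBasics.
Variables (K : fieldType) (L : lieAlgebraType K).
Implicit Types x y z : L.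

Lemma lieD x y z : lie x (y + z) = lie x y + lie x z. Proof. exact: linearD. Qed.
Lemma lieZ (c : K) x y : lie x (c *: y) = c *: lie x y. Proof. exact: linearZ. Qed.
Lemma lie0 x : lie x 0 = 0. Proof. exact: linear0. Qed.
Lemma lieN x y : lie x (- y) = - lie x y. Proof. exact: linearN. Qed.
Lemma lieB x y z : lie x (y - z) = lie x y - lie x z. Proof. exact: linearB. Qed.
Lemma lieDl x y z : lie (x + y) z = lie x z + lie y z. Proof. exact: linearDl. Qed.
Lemma lieZl (c : K) x y : lie (c *: x) y = c *: lie x y. Proof. exact: linearZl_LR. Qed.
Lemma lie0l x : lie 0 x = 0. Proof. exact: linear0l. Qed.

Lemma lieC x y : lie x y = - lie y x.
Proof.
apply/eqP; rewrite -addr_eq0; have := liexx (x + y).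
by rewrite lieDl !lieD !liexx add0r addr0 => ->.
Qed.

Lemma adE x y : ad x y = lie x y. Proof. exact: lfunE. Qed.

Lemma lie_ad x y z : lie x (lie y z) = lie (lie x y) z + lie y (lie x z).
Proof.
have := lie_jacobi x y z; rewrite (lieC z x) lieN (lieC z) => /eqP.
by rewrite subr_eq0 subr_eq => /eqP ->.
Qed.

Lemma memv_centralizer x y : (y \in centralizer x) = (lie x y == 0).
Proof. by rewrite memv_ker adE. Qed.

(** The matrix of ad x acting on row vectors, whence the order of the factors in
    [adm_lie]. *)
Definition adm x := mxof (vbasis {:L}%VS) (vbasis {:L}%VS) (ad x).

Lemma killingE x y : killing x y = \tr (adm x *m adm y).
Proof.
by rewrite /killing (mxof_comp _ _ (vbasisP _)) mxtrace_mulC.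
Qed.

Lemma killingC x y : killing x y = killing y x.
Proof. by rewrite !killingE mxtrace_mulC. Qed.

Lemma ad_linear : linear (@ad K L).
Proof. by move=> c x y; apply/lfunP => z; do !rewrite ?lfunE /=; rewrite lieDl lieZl. Qed.

Lemma admP c x y : adm (c *: x + y) = c *: adm x + adm y.
Proof. by rewrite /adm ad_linear linearP. Qed.

Lemma killingP c x y z : killing (c *: x + y) z = c * killing x z + killing y z.
Proof. by rewrite !killingE admP mulmxDl -scalemxAl mxtraceD mxtraceZ. Qed.

Lemma adm_lie x y : adm (lie x y) = adm y *m adm x - adm x *m adm y.
Proof.
rewrite /adm -!(mxof_comp _ _ (vbasisP _)) -raddfB; congr mxof.
by apply/lfunP => z; do !rewrite ?lfunE /=; rewrite [lie x (lie y z)]lie_ad addrK.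
Qed.

Lemma neg_killing_ad0 x y : ad x = 0 -> neg_killing x y = 0.
Proof.
by move=> ad0; rewrite /neg_killing killingE /adm ad0 linear0 mul0mx mxtrace0 oppr0.
Qed.

Lemma killing_inv x y z : killing (lie x y) z = killing x (lie y z).
Proof.
rewrite !killingE !adm_lie mulmxBl mulmxBr.
rewrite [LHS]raddfB [RHS]raddfB /= !mulmxA; congr (_ - _).
rewrite -[in LHS]mulmxA [LHS]mxtrace_mulC.
reflexivity.
Qed.

End LieBasics.

(** * Negativity of the Killing form for compact groups *)
Section LieAlgebraOfCompactGroup.
Variables (R : realType) (G : lieGroup R) (L : lieAlgebraType R).
Local Notation n := (lgdim G).
Local Notation E := 'rV[R]_n.
Hypothesis cG : compact [set: G].

Lemma Ad_expg (g : G) k : Ad (g ^+ k)%g = Ad g ^+ k.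
Proof.
elim: k => [|k IH]; first by rewrite expg0 expr0 Ad1.
by rewrite expgSr AdM IH exprS.
Qed.

(** The powers of Ad (g_k), for g_k = 1 + X/k in the chart, are values of Ad
    at powers of g_k, hence uniformly bounded. *)
Lemma tangent_skew (X : E) (A : 'M[R]_n) :
  (forall i, row i A = tangent_bracket X (delta_mx 0 i)) ->
  exists Q, [/\ Q^T = Q, posdef Q & A *m Q + Q *m A^T = 0].
Proof.
move=> rowA; have [C AdC] := Ad_bounded cG.
have der := Ad_derive rowA.
pose g k : G := cinv (lgatlas G 1%g) (k.+1%:R^-1 *: X + cmap (lgatlas G 1%g) 1%g).
apply: (@bounded_powers_skew _ _ A (fun k => Ad (g k)) (fun k => Ad (g k)^-1%g) C).
- by move=> k; rewrite -AdM mulVg Ad1.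
- by move=> k m i j; rewrite -Ad_expg.
- by move=> k m i j; rewrite -Ad_expg.
move=> i j.
have h0 : k.+1%:R^-1 @[k --> \oo] --> (0 : R)^'.
  move=> V hV; have hk := @cvg_harmonic R _ hV.
  apply: (@filterS _ (\oo : set_system nat) _
    [set k | (k.+1%:R^-1 : R) != 0 -> V k.+1%:R^-1] _ _ hk) => k; apply.
  by rewrite invr_eq0 pnatr_eq0.
have := cvg_comp _ _ h0 (der i j); rewrite /comp /=.
by under eq_fun do rewrite invrK.
Qed.

Variable f : {linear L -> E}.
Hypothesis bij_f : bijective f.
Hypothesis f_lie : forall x y, f (lie x y) = tangent_bracket (f x) (f y).

(** Transport along f: ad x is conjugate to the matrix of the bracket with f x
    in the tangent space, and the trace of the square is the same. *)
Lemma killing_neg (x : L) : killing x x <= 0 /\ (killing x x = 0 -> ad x = 0).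
Proof.
have [g fK gK] := bij_f.
have g_lin : linear g by move=> c u v; apply: (can_inj fK); rewrite linearP !gK.
pose gl := GRing.isLinear.Build R E L *:%R g g_lin.
pose g' : {linear E -> L} := HB.pack g gl.
pose e := vbasis {:L}%VS.
have eb : basis_of {:L} e := vbasisP _.
pose F := lin1_mx (f \o vecof e).
pose F' := lin1_mx (rVof e \o g').
have FE u : u *m F = f (vecof e u) by exact: mul_rV_lin1.
have F'E u : u *m F' = rVof e (g u) by exact: mul_rV_lin1.
have FF' : F *m F' = 1%:M.
  by apply/row_matrixP => i; rewrite row1 rowE mulmxA FE F'E fK vecofK.
have F'F : F' *m F = 1%:M.
  by apply/row_matrixP => i; rewrite row1 rowE mulmxA F'E FE rVofK // gK.
pose A := F' *m adm x *m F.
have rowA i : row i A = tangent_bracket (f x) (delta_mx 0 i).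
  rewrite rowE /A !mulmxA F'E -rVof_app // FE rVofK // adE.
  by rewrite f_lie gK.
have [Q [symQ pdQ skQ]] := tangent_skew rowA.
have [tr_le tr0] := skew_trace_sq symQ pdQ skQ.
have e1 : \tr (A *m A) = killing x x.
  have -> : A *m A = F' *m (adm x *m adm x) *m F.
    by rewrite /A -!mulmxA (mulmxA F F') FF' mul1mx.
  by rewrite killingE -mulmxA mxtrace_mulC -mulmxA FF' mulmx1.
split; first by rewrite -e1.
rewrite -e1 => /tr0 A0.
have : adm x = F *m A *m F'.
  by rewrite /A !mulmxA FF' mul1mx -mulmxA FF' mulmx1.
rewrite A0 mulmx0 mul0mx => /eqP; rewrite mxof_eq0 //.
by move=> /eqP.
Qed.

End LieAlgebraOfCompactGroup.

(** If <x, x> = 0 then ad x = 0, so the line of x is an abelian ideal. *)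
Lemma neg_killing_gt0 (R : realType) (L : lieAlgebraType R) (x : L) :
  compact_semisimple L -> x != 0 -> 0 < neg_killing x x.
Proof.
move=> [G [cG [f [bij_f f_lie]] ss]] x0.
have [le0 eq0] := killing_neg cG bij_f f_lie x.
rewrite /neg_killing oppr_gt0 lt_neqAle le0 andbT.
apply: contra x0 => /eqP /eq0 adx0.
have xc y : lie x y = 0 by rewrite -adE adx0 lfunE.
have I0 : <[x]>%VS = 0%VS.
  apply: ss.
    rewrite /ideal /lie_space; apply/span_subvP => z /allpairsP [[u v] /= [_ vI ->]].
    have /vlineP [k ->] := vbasis_mem vI.
    by rewrite lieC lieZl xc scaler0 oppr0 mem0v.
  exists 1%N; apply/eqP; rewrite -subv0; apply/span_subvP.
  move=> z /allpairsP [[u v] /= [uI vI ->]].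
  have /vlineP [k ->] := vbasis_mem uI; have /vlineP [k' ->] := vbasis_mem vI.
  by rewrite lieZl xc scaler0 mem0v.
by rewrite -memv0 -I0 memv_line.
Qed.

(** * Indecomposable elements of a symmetric finite set *)

Section IndecomposableWeights.
Variables (R : realFieldType) (V : zmodType) (Phi : seq V) (g : V -> R).
Hypothesis PhiN : forall a, a \in Phi -> - a \in Phi.
Hypothesis gB : {morph g : x y / x - y}.
Hypothesis g_neq0 : forall a, a \in Phi -> g a != 0.

Let M : R := 1 + \sum_(a <- Phi) `|g a|.

Let g_lt a : a \in Phi -> `|g a| < M.
Proof.
move=> aP; rewrite /M (big_rem _ aP) /= addrCA ltrDl.
by rewrite ltr_pwDl // sumr_ge0.
Qed.

Let g0 : g 0 = 0. Proof. by rewrite -(subrr 0) gB subrr. Qed.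
Let gN a : g (- a) = - g a. Proof. by rewrite -sub0r gB g0 sub0r. Qed.
(** The representative modulo M in the interval ]0, M[, on the values of g.
    Reduction modulo M treats simple and lowest roots on the same footing: f is
    a positive function that is additive on a + b = c unless it exceeds M, so
    that a negative root can be reached from the lowest root by adding simple
    roots. *)
Let wrap (x : R) : R := if 0 < x then x else M + x.

Let f a : R := wrap (g a).

(** For two values in ]0, M[, the larger is the smaller plus the reduced
    difference. *)
Let wrap_sub x y : 0 < wrap x < M -> 0 < wrap y < M -> x - y != 0 ->
  wrap x = wrap y + wrap (x - y) \/ wrap y = wrap x + wrap (- (x - y)).
Proof.
rewrite /wrap => /andP[x0 xM] /andP[y0 yM]; rewrite oppr_gt0; move: x0 xM y0 yM.
case: (ltrgt0P (x - y)) => // xy; case: (ltrP 0 x) => hx; case: (ltrP 0 y) => hy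
 x0 xM y0 yM _; first [by left; lra | by right; lra].
Qed.

Let f_bounds a : a \in Phi -> 0 < f a < M.
Proof.
move=> aP; have := g_lt aP; have := g_neq0 aP; rewrite /f /wrap ltr_norml.
case: (ltrgt0P (g a)) => // h _ /andP[h1 h2]; apply/andP; split; lra.
Qed.

(** For a root system and g positive on the simple roots, the indecomposable
    elements are the simple roots and the lowest roots of the components, that
    is, the nodes of the extended Dynkin diagram. *)
Definition indecomposable (a : V) :=
  ~~ has (fun b => (a - b \in Phi) && (f a == f b + f (a - b))) Phi.

Definition indecomposables := [seq a <- undup Phi | indecomposable a].

Lemma indecomposables_sub a : a \in indecomposables -> a \in Phi.
Proof. by rewrite mem_filter mem_undup => /andP[]. Qed.

(** If c = a - b were in Phi, then either f a = f b + f c, which decomposes a, or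
    f b = f a + f (- c), which decomposes b. *)
Lemma indecomposables_diff a b :
  a \in indecomposables -> b \in indecomposables -> a != b -> a - b \notin Phi.
Proof.
move=> aS bS ab; have aP := indecomposables_sub aS; have bP := indecomposables_sub bS.
apply/negP => cP; have NcP := PhiN cP; rewrite opprB in NcP.
move: aS bS; rewrite !mem_filter => /andP[/hasPn ia _] /andP[/hasPn ib _].
have := ia _ bP; rewrite cP /= => /eqP; apply.
have := ib _ aP; rewrite NcP /= => /eqP hb.
have := f_bounds aP; have := f_bounds bP; have := g_neq0 cP; have := f_bounds cP.
have cP' := g_neq0 cP; rewrite gB in cP'.
by case: (wrap_sub (f_bounds aP) (f_bounds bP) (cP')) => h; [|case: hb];
  rewrite /f -?[b - a]opprB ?gN gB.
Qed.

(** Induction on f a: in a decomposition a = b + c with f a = f b + f c both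
    f b and f c are positive, hence smaller than f a. *)
Lemma indecomposables_span a : a \in Phi ->
  exists m : V -> nat, a = \sum_(s <- indecomposables) s *+ m s.
Proof.
(* the values of f are real, so the induction is on the rank of f a *)
have [n] := ubnP (count (fun b => f b < f a) Phi).
elim: n a => // n IH a; rewrite ltnS => an aP.
have [ia|] := boolP (indecomposable a).
  exists (fun s => (s == a)).
  have aS : a \in indecomposables by rewrite mem_filter ia mem_undup.
  have uS : uniq indecomposables by rewrite filter_uniq ?undup_uniq.
  rewrite (bigD1_seq a) //= eqxx mulr1n big1 ?addr0 // => s /negPf ->.
  by rewrite mulr0n.
rewrite negbK => /hasP[b bP /andP[cP /eqP fE]].
have /andP[b0 _] := f_bounds bP; have /andP[c0 _] := f_bounds cP.
have smaller c : c \in Phi -> f c < f a -> exists m : V -> nat,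
    c = \sum_(s <- indecomposables) s *+ m s.
  move=> cPhi ca; apply: IH => //; apply: leq_trans an.
  have := count_predUI (fun e => f e < f c) (pred1 c) Phi.
  rewrite [X in (_ + X)%N = _](_ : _ = 0)%N; last first.
    apply/eqP; rewrite -leqn0 leqNgt -has_count; apply/hasPn => e _ /=.
    by apply/negP => /andP[ltc /eqP ec]; rewrite ec ltxx in ltc.
  rewrite addn0 => cE.
  apply: (@leq_trans (count (predU (fun e => f e < f c) (pred1 c)) Phi)).
    by rewrite cE -addn1 leq_add2l -has_count has_pred1.
  apply: sub_count => e /= /orP[ec|/eqP -> //]; exact: (lt_trans ec ca).
have [//|m1 m1E] := smaller b bP; first by lra.
have [//|m2 m2E] := smaller (a - b) cP; first by lra.
exists (fun s => m1 s + m2 s)%N.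
under eq_bigr do rewrite mulrnDr.
by rewrite big_split /= -m1E -m2E addrC subrK.
Qed.

(** Each - s with s indecomposable lies in Phi, hence is a sum of indecomposables;
    the sum of the relations s + (- s) = 0 has all coefficients positive. *)
Lemma indecomposables_relation : exists m : V -> nat,
  (forall s, 0 < m s)%N /\ \sum_(s <- indecomposables) s *+ m s = 0.
Proof.
have mN (s : V) : {m : V -> nat | s \in Phi ->
    - s = \sum_(t <- indecomposables) t *+ m t}.
  apply: cid; have [sP|_] := boolP (s \in Phi); last by exists (fun=> 0%N).
  by have [m mE] := indecomposables_span (PhiN sP); exists m.
exists (fun t => (\sum_(s <- indecomposables) projT1 (mN s) t).+1); split=> //.
under eq_bigr do rewrite mulrS.
rewrite big_split /=.
under [X in _ + X]eq_bigr do rewrite -sumrMnr.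
rewrite exchange_big /= -big_split big1_seq //= => s sS.
by rewrite -(projT2 (mN s)) ?subrr // indecomposables_sub.
Qed.

End IndecomposableWeights.

(** * Lie algebras with an invariant inner product *)

(** How finiteness of the set of roots is obtained from a linear independence
    bound. *)
Lemma enumerate_bounded (T : eqType) (P : T -> Prop) (N : nat) :
  (forall s, uniq s -> (forall x, x \in s -> P x) -> (size s <= N)%N) ->
  exists2 s, uniq s & forall x, x \in s <-> P x.
Proof.
move=> bound; apply: contrapT => none.
have long k : exists s : seq T, [/\ uniq s, forall x, x \in s -> P x & size s = k].
  elim: k => [|k [s [us sP <-]]]; first by exists [::].
  have [x Px xs] : exists2 x, P x & x \notin s.
    apply: contrapT => h; apply: none; exists s => // x; split; first exact: sP.
    by move=> Px; apply/negPn/negP => xs; apply: h; exists x.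
  exists (x :: s); split => //=; first by rewrite xs.
  by move=> y; rewrite inE => /orP[/eqP ->|/sP].
have [s [us sP sN]] := long N.+1.
by have := bound s us sP; rewrite sN ltnn.
Qed.

Section CompactAlgebra.
Variables (R : realType) (L : lieAlgebraType R).
Implicit Types (x y z : L) (U V : {vspace L}).

Variable dot : L -> L -> R.
Hypothesis dotC : forall x y, dot x y = dot y x.
Hypothesis dotP : forall c x y z, dot (c *: x + y) z = c * dot x z + dot y z.
Hypothesis dot_lie : forall x y z, dot (lie x y) z = dot x (lie y z).
Hypothesis dot_gt0 : forall x, x != 0 -> 0 < dot x x.
Hypothesis centerless : forall x, (forall y, lie x y = 0) -> x = 0.

Lemma dotDl x y z : dot (x + y) z = dot x z + dot y z.
Proof. by rewrite -[x]scale1r dotP mul1r scale1r. Qed.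

Lemma dot0l x : dot 0 x = 0.
Proof. by apply: (addIr (dot 0 x)); rewrite -dotDl !add0r. Qed.

Lemma dotZl c x z : dot (c *: x) z = c * dot x z.
Proof. by rewrite -[c *: x]addr0 dotP dot0l addr0. Qed.

Lemma dotNl x z : dot (- x) z = - dot x z.
Proof. by rewrite -scaleN1r dotZl mulN1r. Qed.

Lemma dotBl x y z : dot (x - y) z = dot x z - dot y z.
Proof. by rewrite dotDl dotNl. Qed.

Lemma dotDr x y z : dot z (x + y) = dot z x + dot z y.
Proof. by rewrite dotC dotDl !(dotC _ z). Qed.

Lemma dot0r x : dot x 0 = 0. Proof. by rewrite dotC dot0l. Qed.

Lemma dotZr c x z : dot z (c *: x) = c * dot z x.
Proof. by rewrite dotC dotZl (dotC x). Qed.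

Lemma dotNr x z : dot z (- x) = - dot z x.
Proof. by rewrite dotC dotNl (dotC x). Qed.

Lemma dotBr x y z : dot z (x - y) = dot z x - dot z y.
Proof. by rewrite dotDr dotNr. Qed.

Lemma dot_suml (I : Type) (r : seq I) (F : I -> L) z :
  dot (\sum_(i <- r) F i) z = \sum_(i <- r) dot (F i) z.
Proof. by elim/big_rec2: _ => [|i y1 y2 _ <-]; rewrite ?dot0l ?dotDl. Qed.

Lemma dot_eq0 x : dot x x = 0 -> x = 0.
Proof. by move=> h; apply: contra_eq h => /dot_gt0; rewrite lt0r => /andP[]. Qed.

Lemma dot_ge0 x : 0 <= dot x x.
Proof. by have [->|/dot_gt0/ltW//] := eqVneq x 0; rewrite dot0l. Qed.

Lemma dot_skew x y z : dot (lie x y) z = - dot y (lie x z).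
Proof. by rewrite lieC dotNl dot_lie. Qed.

Lemma lie_sum (I : Type) (r : seq I) (F : I -> L) x :
  lie x (\sum_(i <- r) F i) = \sum_(i <- r) lie x (F i).
Proof. exact: linear_sum. Qed.

Lemma lie_suml (I : Type) (r : seq I) (F : I -> L) x :
  lie (\sum_(i <- r) F i) x = \sum_(i <- r) lie (F i) x.
Proof. by elim/big_rec2: _ => [|i y1 y2 _ <-]; rewrite ?lie0l ?lieDl. Qed.

(** A skew map has the same kernel as its square. *)
Lemma lie_sq0 x y : lie x (lie x y) = 0 -> lie x y = 0.
Proof. by move=> h; apply: dot_eq0; rewrite dot_skew h dot0r oppr0. Qed.

Lemma memv_lie_space U V x y : x \in U -> y \in V -> lie x y \in lie_space U V.
Proof.
move=> xU yV; rewrite (coord_vbasis xU) (coord_vbasis yV) lie_suml memv_suml // => i _.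
rewrite lie_sum memv_suml // => j _; rewrite lieZ lieZl !memvZ //.
apply: memv_span; apply/allpairsP; exists ((vbasis U)`_i, (vbasis V)`_j).
by rewrite /= !mem_nth ?size_tuple.
Qed.

(** For x, y in U some power of ad x kills y, and by [lie_sq0] already ad x
    does. *)
Lemma nilpotent_abelian U : nilpotent_space U ->
  forall x y, x \in U -> y \in U -> lie x y = 0.
Proof.
move=> [n nU] x y xU yU.
have : iter n (lie x) y = 0.
  apply/eqP; rewrite -memv0 -nU.
  by elim: n {nU} => //= n IH; exact: memv_lie_space.
elim: n {nU} => [/= ->|]; first exact: lie0.
case=> [//|n] IH /= h; apply: IH => /=; exact: lie_sq0.
Qed.

(** An abelian centralizer is self-normalizing: if [y, x] commutes with x, then
    [x, [x, y]] = 0, so [x, y] = 0. *)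
Lemma abelian_regular x :
  (forall y z, y \in centralizer x -> z \in centralizer x -> lie y z = 0) ->
  regular x.
Proof.
move=> ab.
have l0 : lie_space (centralizer x) (centralizer x) = 0%VS.
  apply/eqP; rewrite -subv0; apply/span_subvP => _ /allpairsP [[u v] /= [uZ vZ ->]].
  by rewrite ab ?mem0v // vbasis_mem.
split; first by rewrite /subalgebra l0 sub0v.
  by exists 1%N.
move=> y hy; rewrite memv_centralizer; apply/eqP.
have := hy x; rewrite !memv_centralizer liexx eqxx => /(_ isT)/eqP h.
by apply: lie_sq0; rewrite (lieC x y) lieN h oppr0.
Qed.

Lemma orthogonal_free (T : eqType) (s : seq T) (F : T -> L) : uniq s ->
  (forall i, i \in s -> F i != 0) ->
  (forall i j, i \in s -> j \in s -> i != j -> dot (F i) (F j) = 0) ->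
  (size s <= \dim {:L})%N.
Proof.
move=> us nz orth; rewrite -(size_map F).
have fr : free (map F s).
  elim: s us nz orth => [_ _ _|i s IH] /=; first exact: nil_free.
  move=> /andP[is_ us] nz orth; rewrite free_cons IH //; last 2 first.
  - by move=> j js; apply: nz; rewrite inE js orbT.
  - by move=> j k js ks; apply: orth; rewrite inE ?js ?ks orbT.
  rewrite andbT; apply/negP => Fi.
  have : dot (F i) (F i) = 0.
    rewrite {2}(coord_span (X := in_tuple _) Fi) dotC dot_suml big1 // => j _.
    rewrite dotZl (nth_map i) ?orth ?mulr0 ?mem_head //.
    - by rewrite inE mem_nth ?orbT // -(size_map F).
    - apply: contraNneq is_ => <-; apply: mem_nth; by rewrite -(size_map F).
    by rewrite -(size_map F).
  by move=> /dot_eq0/eqP; apply/negP; apply: nz; rewrite mem_head.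
by rewrite -(eqnP fr) dimvS // subvf.
Qed.

(** Pairing with a basis of U maps V injectively to a space of dimension
    dim U. *)
Lemma subspace_eq_orthogonal U V : (U <= V)%VS ->
  (forall x, x \in V -> (forall y, y \in U -> dot y x = 0) -> x = 0) -> U = V.
Proof.
move=> UV h; apply/eqP; rewrite eqEdim UV /=.
pose F x : 'rV[R]_(\dim U) := \row_i dot (vbasis U)`_i x.
have F_lin : linear F by move=> c x y; apply/rowP => i; rewrite !mxE dotDr dotZr.
pose Fl : {linear L -> 'rV[R]_(\dim U)} :=
  HB.pack F (GRing.isLinear.Build R L 'rV[R]_(\dim U) *:%R F F_lin).
have := limg_ker_dim (linfun Fl) V.
have -> : (V :&: lker (linfun Fl))%VS = 0%VS.
  apply/eqP; rewrite -subv0; apply/subvP => x; rewrite memv_cap memv_ker lfunE /=.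
  move=> /andP[xV /eqP Fx]; rewrite memv0; apply/eqP; apply: h => // y yU.
  rewrite (coord_vbasis yU) dot_suml big1 // => i _; rewrite dotZl.
  by have /rowP/(_ i) := Fx; rewrite !mxE => ->; rewrite mulr0.
rewrite dimv0 add0n => <-; apply: leq_trans (dimvS (subvf _)) _.
by rewrite dimvf dim_matrix mul1r.
Qed.

(** If c fails, some z satisfies [x, z] = - c [y, z] with [y, z] nonzero. Since
    ad x and ad y are skew and commute, the vectors [y, z] for distinct c are
    orthogonal, as eigenvectors of a symmetric map would be; so only finitely
    many c fail. *)
Lemma commuting_generic x y : lie x y = 0 ->
  exists c : R, forall z, lie (x + c *: y) z = 0 -> lie x z = 0 /\ lie y z = 0.
Proof.
move=> xy.
have yx : lie y x = 0 by rewrite lieC xy oppr0.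
apply: contrapT => none.
have bad (c : R) : {z | lie (x + c *: y) z = 0 /\ lie y z != 0}.
  apply: cid; apply: contrapT => h; apply: none; exists c => z z0.
  have yz : lie y z = 0.
    by apply/eqP/negPn/negP => yz; apply: h; exists z.
  by split => //; move: z0; rewrite lieDl lieZl yz scaler0 addr0.
pose z c := sval (bad c).
have xz c : lie x (z c) = - c *: lie y (z c).
  have [] := svalP (bad c); rewrite -/(z c) lieDl lieZl => /eqP.
  by rewrite addr_eq0 scaleNr => /eqP.
have swap u : lie x (lie y u) = lie y (lie x u).
  by rewrite lie_ad xy lie0l add0r.
pose s : seq R := [seq i%:R | i <- iota 0 (\dim {:L}).+1].
have : (size s <= \dim {:L})%N.
  apply: (@orthogonal_free _ s (fun c => lie y (z c))).
  - by rewrite map_inj_uniq ?iota_uniq // => i j /eqP; rewrite eqr_nat => /eqP.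
  - by move=> c _; have [] := svalP (bad c).
  move=> c c' _ _ cc'.
  have h : - c * dot (lie y (z c)) (lie y (z c')) = - c' * dot (lie y (z c)) (lie y (z c')).
    by rewrite -dotZl -xz -dotZr -xz [LHS]dot_skew swap -dot_skew.
  by apply/eqP; have /eqP := h; rewrite -subr_eq0 -mulrBl mulf_eq0 opprK
    addrC subr_eq0 eq_sym (negPf cc').
by rewrite size_map size_iota ltnn.
Qed.

(** Among the elements whose centralizer is contained in that of a generic
    combination of x and y, one with minimal centralizer is regular: if u and v
    in Z(x) do not commute, a generic x + k u has a smaller centralizer, since
    that excludes v. *)
Lemma commuting_regular x y : lie x y = 0 ->
  exists b, regular b /\
    forall z, z \in centralizer b -> lie x z = 0 /\ lie y z = 0.
Proof.
move=> /commuting_generic[c hc].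
suff [b [bab bsub]] : exists b,
    (forall u v, u \in centralizer b -> v \in centralizer b -> lie u v = 0) /\
    (centralizer b <= centralizer (x + c *: y)%R)%VS.
  exists b; split; first exact: abelian_regular.
  move=> z /(subvP bsub); rewrite memv_centralizer => /eqP; exact: hc.
move: (x + c *: y) => {x y hc} x.
have [n] := ubnP (\dim (centralizer x)).
elim: n x => // n IH x; rewrite ltnS => xn.
have [ab|] := pselect (forall u v, u \in centralizer x -> v \in centralizer x -> lie u v = 0).
  by exists x.
move=> /existsNP[u /existsNP[v /not_implyP[ux /not_implyP[vx /eqP uv]]]].
have /commuting_generic[k hk] : lie x u = 0 by apply/eqP; rewrite -memv_centralizer.
have sub : (centralizer (x + k *: u)%R <= centralizer x)%VS.
  apply/subvP => z; rewrite !memv_centralizer => /eqP /hk[-> _]; exact: eqxx.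
have [|b [bab bsub]] := IH (x + k *: u).
  apply: leq_trans xn; rewrite ltn_neqAle (dimv_leqif_sup sub) dimvS // andbT.
  apply/negP => /subvP/(_ v vx); rewrite memv_centralizer => /eqP /hk[_ uv0].
  by rewrite uv0 eqxx in uv.
by exists b; split => //; exact: subv_trans sub.
Qed.

(** Real and imaginary part of a complex eigenvector. *)
Lemma real_symmetric_complex_pair d (M : 'M[R]_d) : (0 < d)%N ->
  exists (a b : R) (x y : 'rV[R]_d),
    [/\ (x != 0) || (y != 0), x *m M = a *: x - b *: y & y *m M = b *: x + a *: y].
Proof.
move=> d0.
have [l /eigenvalueP[w wM w0]] := eigenvalue_closed (map_mx (real_complex R) M) d0.
have sumC (F : 'I_d -> R[i]) : complex.Re (\sum_i F i) = \sum_i complex.Re (F i) /\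
    complex.Im (\sum_i F i) = \sum_i complex.Im (F i).
  split; [elim/big_rec2: _ => // i p q _ <-|elim/big_rec2: _ => // i p q _ <-];
    by case: (F i) => ? ?; case: q.
exists (complex.Re l), (complex.Im l), (map_mx (@complex.Re R) w), (map_mx (@complex.Im R) w).
have entry j := congr1 (fun v : 'rV[R[i]]_d => v 0 j) wM.
split.
- apply: contraNT w0; rewrite negb_or !negbK => /andP[/eqP x0 /eqP y0].
  apply/eqP/rowP => j; have /rowP/(_ j) := x0; have /rowP/(_ j) := y0.
  by rewrite !mxE; case: (w 0 j) => p q /= -> ->.
- apply/rowP => j; have := congr1 (@complex.Re R) (entry j); rewrite !mxE (sumC _).1.
  rewrite (eq_bigr (fun i => (map_mx (@complex.Re R) w) 0 i * M i j)) => [->|i _].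
    by case: (w 0 j) => p q; case: l {wM entry} => p' q' /=.
  by rewrite !mxE; case: (w 0 i) => p q /=; rewrite mulr0 subr0.
- apply/rowP => j; have := congr1 (@complex.Im R) (entry j); rewrite !mxE (sumC _).2.
  rewrite (eq_bigr (fun i => (map_mx (@complex.Im R) w) 0 i * M i j)) => [->|i _].
    by case: (w 0 j) => p q; case: l {wM entry} => p' q' /=; ring.
  by rewrite !mxE; case: (w 0 i) => p q /=; rewrite mulr0 add0r.
Qed.

(** For a complex eigenvector x + i y with eigenvalue a + i b, symmetry gives
    b (<x, x> + <y, y>) = 0, so that b = 0. *)
Lemma symmetric_eigenvector U (C : 'End(L)) : U != 0%VS ->
  (forall u, u \in U -> C u \in U) -> (forall u v, dot (C u) v = dot u (C v)) ->
  exists (a : R) u, [/\ u \in U, u != 0 & C u = a *: u].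
Proof.
move=> U0 CU symC; have d0 : (0 < \dim U)%N by rewrite lt0n dimv_eq0.
pose M : 'M[R]_(\dim U) := \matrix_(i, j) coord (vbasis U) j (C (vbasis U)`_i).
pose vec (r : 'rV[R]_(\dim U)) := \sum_i r 0 i *: (vbasis U)`_i.
have bU i : (i < \dim U)%N -> (vbasis U)`_i \in U.
  by move=> iU; apply: vbasis_mem; rewrite mem_nth // size_tuple.
have vecU r : vec r \in U by apply: memv_suml => i _; rewrite memvZ // bU.
have vecC r : C (vec r) = vec (r *m M).
  rewrite /vec linear_sum /=.
  transitivity (\sum_i \sum_j (r 0 i * M i j) *: (vbasis U)`_j).
    apply: eq_bigr => i _; rewrite linearZ /= {1}(coord_vbasis (CU _ (bU _ (ltn_ord i)))).
    by rewrite scaler_sumr; apply: eq_bigr => j _; rewrite scalerA mxE.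
  rewrite exchange_big /=; apply: eq_bigr => j _.
  by rewrite mxE scaler_suml.
have vec0 r : vec r = 0 -> r = 0.
  have /freeP h := basis_free (vbasisP U).
  by move=> /h r0; apply/rowP => i; rewrite r0 mxE.
have vecD r s : vec (r + s) = vec r + vec s.
  by rewrite /vec -big_split; apply: eq_bigr => i _; rewrite mxE scalerDl.
have vecZ c r : vec (c *: r) = c *: vec r.
  by rewrite /vec scaler_sumr; apply: eq_bigr => i _; rewrite mxE scalerA.
have [a [b [x [y [xy xM yM]]]]] := real_symmetric_complex_pair M d0.
have Cx : C (vec x) = a *: vec x - b *: vec y.
  by rewrite vecC xM vecD vecZ -scaleNr vecZ scaleNr.
have Cy : C (vec y) = b *: vec x + a *: vec y by rewrite vecC yM vecD !vecZ.
have b0 : b = 0.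
  have := symC (vec x) (vec y); rewrite Cx Cy dotBl !dotZl dotDr !dotZr => h.
  have {}h : b * (dot (vec x) (vec x) + dot (vec y) (vec y)) = 0 by lra.
  move/eqP: h; rewrite mulf_eq0 => /orP[/eqP //|].
  rewrite paddr_eq0 ?dot_ge0 // => /andP[/eqP /dot_eq0/vec0 x0 /eqP /dot_eq0/vec0 y0].
  by move: xy; rewrite x0 y0 eqxx.
rewrite b0 !scale0r subr0 in Cx; rewrite b0 scale0r add0r in Cy.
case/orP: xy => [x0|y0].
  exists a, (vec x); split => //; by apply: contra x0 => /eqP/vec0 ->.
exists a, (vec y); split => //; by apply: contra y0 => /eqP/vec0 ->.
Qed.

Variable a : L.
Hypothesis reg_a : regular a.
Local Notation H := (centralizer a).

Let aH : a \in H. Proof. by rewrite memv_centralizer liexx. Qed.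

Let H_ab x y : x \in H -> y \in H -> lie x y = 0.
Proof. by have [_ nilH _] := reg_a; exact: nilpotent_abelian. Qed.

(** Over the complex numbers, u - i v and u + i v span the weight spaces of H for
    the weights i <., t> and - i <., t>. *)
Definition weight_pair t u v :=
  forall h, h \in H -> lie h u = dot h t *: v /\ lie h v = - dot h t *: u.

Definition root t := [/\ t \in H, t != 0 &
  exists u v, u != 0 /\ weight_pair t u v].

Lemma weight_pair_norm t u v : t \in H -> t != 0 -> weight_pair t u v ->
  dot u u = dot v v.
Proof.
move=> tH t0 /(_ t tH)[tu tv].
have := dot_skew t u v; rewrite tu tv dotZl dotZr mulNr opprK => /mulfI -> //.
by rewrite gt_eqF // dot_gt0.
Qed.

(** [u, v] commutes with a, so it lies in H, and by invariance its product with
    each h in H is that of a multiple of t. *)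
Lemma weight_pair_lie t u v : t \in H -> t != 0 -> weight_pair t u v ->
  lie u v = dot v v *: t.
Proof.
move=> tH t0 wp.
have uvH : lie u v \in H.
  have [au av] := wp a aH.
  by rewrite memv_centralizer lie_ad au av lieZl lieZ !liexx !scaler0 addr0.
apply/eqP; rewrite -subr_eq0; apply/eqP; apply: dot_eq0.
have xH : lie u v - dot v v *: t \in H by rewrite memvB ?memvZ.
suff key h : h \in H -> dot h (lie u v - dot v v *: t) = 0 by exact: key.
move=> hH; have [hu _] := wp h hH.
by rewrite dotBr -dot_lie hu dotZl dotZr mulrC subrr.
Qed.

(** Otherwise u commutes with a, so u lies in the abelian H, on which t acts by
    zero; but t moves u to a nonzero multiple of v. This makes <a, .> a valid
    ordering function for the roots. *)
Lemma root_value_neq0 t : root t -> dot a t != 0.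
Proof.
move=> [tH t0 [u [v [u0 wp]]]]; apply: contra u0 => /eqP at0.
have uH : u \in H by rewrite memv_centralizer (wp a aH).1 at0 scale0r.
have := (wp t tH).1; rewrite H_ab // => /esym/eqP.
rewrite scaler_eq0 gt_eqF ?dot_gt0 //= => /eqP v0.
by apply/eqP/dot_eq0; rewrite (weight_pair_norm tH t0 wp) v0 dot0l.
Qed.

Lemma weight_pairN t u v : weight_pair t u v -> weight_pair (- t) u (- v).
Proof.
move=> wp h hH; have [hu hv] := wp h hH.
by rewrite dotNr opprK lieN hu hv scalerN scaleNr opprK scaleNr opprK.
Qed.

Lemma rootN t : root t -> root (- t).
Proof.
move=> [tH t0 [u [v [u0 wp]]]]; split; rewrite ?memvN ?oppr_eq0 //.
by exists u, (- v); split => //; exact: weight_pairN.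
Qed.

(** Skewness of ad h gives <h, t> <u, u'> = <h, s> <v, v'> and the same with the
    two products exchanged; h = t - s and h = t + s then show that their sum and
    their difference vanish. *)
Lemma weight_pair_orthogonal t s u v u' v' : t \in H -> s \in H ->
  t != s -> t != - s -> weight_pair t u v -> weight_pair s u' v' -> dot u u' = 0.
Proof.
move=> tH sH ts tNs wt ws.
have e1 h : h \in H -> dot h t * dot u u' = dot h s * dot v v'.
  move=> hH; have [_ hv] := wt h hH; have [hu' _] := ws h hH.
  by have := dot_skew h v u'; rewrite hv hu' dotZl dotZr mulNr => /oppr_inj.
have e2 h : h \in H -> dot h t * dot v v' = dot h s * dot u u'.
  move=> hH; have [hu _] := wt h hH; have [_ hv'] := ws h hH.
  by have := dot_skew h u v'; rewrite hu hv' dotZl dotZr mulNr opprK.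
have p1 : dot u u' + dot v v' = 0.
  have tsH : t - s \in H by rewrite memvB.
  have : dot (t - s) (t - s) * (dot u u' + dot v v') = 0.
    have := e1 _ tsH; have := e2 _ tsH; rewrite [dot (t - s) (t - s)]dotBr; lra.
  have ts0 : t - s != 0 by rewrite subr_eq0.
  by move/eqP; rewrite mulf_eq0 (gt_eqF (dot_gt0 ts0)) => /eqP.
have p2 : dot u u' - dot v v' = 0.
  have tsH : t + s \in H by rewrite memvD.
  have : dot (t + s) (t + s) * (dot u u' - dot v v') = 0.
    have := e1 _ tsH; have := e2 _ tsH; rewrite [dot (t + s) (t + s)]dotDr; lra.
  have ts0 : t + s != 0 by rewrite addr_eq0.
  by move/eqP; rewrite mulf_eq0 (gt_eqF (dot_gt0 ts0)) => /eqP.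
lra.
Qed.

(** It is enough to bound the number of roots with <a, t> > 0: no two of these
    are opposite, so that their vectors u are orthogonal. *)
Lemma root_enum : exists Phi : seq L, forall t, t \in Phi <-> root t.
Proof.
have [s _ sP] : exists2 s : seq L, uniq s & forall t, t \in s <-> (root t /\ 0 < dot a t).
  apply: (@enumerate_bounded _ _ (\dim {:L})) => s us sP.
  have vec t : {u | t \in s -> exists v, u != 0 /\ weight_pair t u v}.
    apply: cid; have [/sP [[_ _ [u [v uv]]] _]|] := boolP (t \in s); last by exists 0.
    by exists u => _; exists v.
  apply: (orthogonal_free (F := fun t => sval (vec t)) us).
    by move=> t ts; have [v []] := svalP (vec t) ts.
  move=> t t' ts ts' tt'.
  have [v [_ wt]] := svalP (vec t) ts; have [v' [_ wt']] := svalP (vec t') ts'.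
  have [[tH _ _] at0] := sP _ ts; have [[tH' _ _] at'] := sP _ ts'.
  apply: weight_pair_orthogonal wt wt' => //.
  apply/negP => /eqP tN; move: at0; rewrite tN dotNr oppr_gt0 => /(lt_trans at').
  by rewrite ltxx.
exists (s ++ map -%R s) => t; rewrite mem_cat; split.
  case/orP => [/sP[]//|/mapP[u us ->]]; by apply: rootN; have [] := (sP u).1 us.
move=> rt; have := root_value_neq0 rt.
case: (ltrgt0P (dot a t)) => // at0 _; apply/orP; [left|right]; first exact/sP.
apply/mapP; exists (- t); last by rewrite opprK.
by apply/sP; split; [exact: rootN|rewrite dotNr oppr_gt0].
Qed.

(** The product of a weight vector of weight t with one of weight - s has weight
    t - s; these are the real and imaginary parts of (u + i v) (u' - i v'). *)
Lemma weight_pair_cross t s u v u' v' : weight_pair t u v -> weight_pair s u' v' ->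
  weight_pair (t - s) (lie u u' + lie v v') (lie v u' - lie u v').
Proof.
move=> wt ws h hH; have [hu hv] := wt h hH; have [hu' hv'] := ws h hH.
rewrite lieD lieB !(lie_ad h) hu hv hu' hv' !(lieZ, lieZl) dotBr.
move: (dot h t) (dot h s) (lie u u') (lie v v') (lie v u') (lie u v') => c d p q x y.
rewrite opprB !scaleNr; split.
  by rewrite addrACA scalerBl !scalerBr [in RHS]opprB.
rewrite opprB addrACA [- _ + _]addrC scalerBl !scalerDr opprD.
by rewrite [RHS]addrACA.
Qed.

(** The weight vector of weight t - s vanishes as t - s is not a root. *)
Lemma weight_pair_cross0 t s u v u' v' : t \in H -> s \in H -> t != s ->
  ~ root (t - s) -> weight_pair t u v -> weight_pair s u' v' ->
  lie u v' = lie v u'.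
Proof.
move=> tH sH ts nr wt ws.
have tsH : t - s \in H by rewrite memvB.
have ts0 : t - s != 0 by rewrite subr_eq0.
have wc := weight_pair_cross wt ws.
have A0 : lie u u' + lie v v' = 0.
  apply/eqP/negPn/negP => A0; apply: nr; split => //.
  by exists (lie u u' + lie v v'), (lie v u' - lie u v').
have := (wc _ tsH).1; rewrite A0 lie0 => /esym/eqP.
by rewrite scaler_eq0 gt_eqF ?dot_gt0 //= subr_eq0 => /eqP.
Qed.

(** On a minimal nonzero H-stable subspace U of [h, L], for each x in H the
    symmetric map ad x ad h commutes with H, so that its eigenspaces are stable
    and it is a scalar m x. As - m h is positive, with square root l, the
    vectors u in U and v = [h, u] / l form a weight pair. Its root, obtained as
    a multiple of [u, v], is not orthogonal to h because h moves u. *)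
Lemma root_nonorthogonal h : h \in H -> h != 0 -> exists2 t, root t & dot h t != 0.
Proof.
move=> hH h0.
pose stable U := forall x u, x \in H -> u \in U -> lie x u \in U.
(* working inside [h, L] ensures that ad h is injective on U *)
have [U [U0 stU UW Umin]] : exists U, [/\ U != 0%VS, stable U, (U <= limg (ad h))%VS &
    forall U', (U' <= U)%VS -> U' != 0%VS -> stable U' -> U' = U].
  have W0 : limg (ad h) != 0%VS.
    apply: contra h0 => /eqP W0; apply/eqP/centerless => y.
    by apply/eqP; rewrite -memv0 -W0 -adE memv_img ?memvf.
  have stW : stable (limg (ad h)).
    move=> x u xH /memv_imgP[y _ ->]; rewrite adE lie_ad (H_ab xH hH) lie0l add0r.
    by rewrite -adE memv_img ?memvf.
  suff main n : forall W, (\dim W < n)%N -> W != 0%VS -> stable W ->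
      exists U, [/\ U != 0%VS, stable U, (U <= W)%VS &
        forall U', (U' <= U)%VS -> U' != 0%VS -> stable U' -> U' = U].
    exact: (main _ _ (ltnSn _) W0 stW).
  elim: n => // n IH W; rewrite ltnS => Wn {}W0 {}stW.
  have [min|] := pselect (forall U', (U' <= W)%VS -> U' != 0%VS -> stable U' -> U' = W).
    by exists W; split => //; exact: subvv.
  move=> /existsNP[U /not_implyP[UW /not_implyP[U0 /not_implyP[stU /eqP UneW]]]].
  have [|U1 [U10 stU1 U1U min]] := IH U _ U0 stU.
    by apply: leq_trans Wn; rewrite ltn_neqAle (dimv_leqif_eq UW) UneW dimvS.
  by exists U1; split => //; exact: subv_trans U1U UW.
have swap x y z : x \in H -> y \in H -> lie x (lie y z) = lie y (lie x z).
  by move=> xH yH; rewrite lie_ad (H_ab xH yH) lie0l add0r.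
have scal x : x \in H -> exists m : R, forall u, u \in U -> lie x (lie h u) = m *: u.
  move=> xH; pose C := (ad x \o ad h)%VF.
  have CE u : C u = lie x (lie h u) by rewrite comp_lfunE !adE.
  have [||m [u [uU u0 Cu]]] := symmetric_eigenvector (C := C) U0.
  - by move=> u uU; rewrite CE stU // stU.
  - move=> u w; by rewrite !CE dot_skew dot_skew opprK (swap h x).
  exists m => w wU.
  pose U' := (U :&: lker (C - m *: \1%VF))%VS.
  have memU' z : (z \in U') = (z \in U) && (lie x (lie h z) == m *: z).
    rewrite memv_cap memv_ker add_lfunE opp_lfunE scale_lfunE id_lfunE CE.
    by rewrite subr_eq0.
  have U'U : U' = U.
    apply: Umin; first exact: capvSl.
      by apply/eqP => U'0; move: u0; rewrite -memv0 -U'0 memU' uU -CE Cu eqxx.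
    move=> y z yH; rewrite !memU' => /andP[zU /eqP zE]; rewrite stU //=.
    by rewrite (swap h y) // (swap x y) // zE lieZ.
  by move: wU; rewrite -U'U memU' => /andP[_ /eqP].
have uU := memv_pick U; set u := vpick U in uU.
have u0 : u != 0 by rewrite vpick0.
pose m x := if pselect (x \in H) is left xH then sval (cid (scal x xH)) else 0.
have mE x w : x \in H -> w \in U -> lie x (lie h w) = m x *: w.
  by move=> xH wU; rewrite /m; case: pselect => // xH'; case: cid => ? /= ->.
pose w := lie h u.
have w0 : w != 0.
  have /memv_imgP[y _ uE] := subvP UW _ uU.
  apply: contra u0 => /eqP; rewrite /w uE adE => /lie_sq0 ->; exact: eqxx.
have mh : - m h * dot u u = dot w w.
  by rewrite mulNr -dotZl -mE // dot_skew opprK.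
have mh0 : 0 < - m h.
  by rewrite -(pmulr_lgt0 _ (dot_gt0 u0)) mh dot_gt0.
pose l := Num.sqrt (- m h).
have l0 : 0 < l by rewrite sqrtr_gt0.
have ll : l * l = - m h by rewrite -expr2 sqr_sqrtr // ltW.
have [v vE] : exists v, v = l^-1 *: w by exists (l^-1 *: w).
have v0 : v != 0 by rewrite vE scaler_eq0 invr_eq0 gt_eqF.
have hv x : x \in H -> lie x v = (m x / l) *: u.
  by move=> xH; rewrite vE lieZ mE // scalerA mulrC.
have hu x : x \in H -> lie x u = - (m x / l) *: v.
  move=> xH; have mh1 : m h != 0 by rewrite -oppr_eq0 gt_eqF.
  have -> : u = (m h)^-1 *: lie h w by rewrite /w mE // scalerA mulVf // scale1r.
  rewrite lieZ (swap x h) // {1}/w mE // lieZ -/w scalerA vE scalerA; congr (_ *: _).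
  rewrite -[m h]opprK -ll; field.
  by rewrite gt_eqF.
have vv : dot v v = dot u u.
  have c0 : m h / l != 0.
    by rewrite mulf_neq0 ?invr_eq0 ?(gt_eqF l0) // -oppr_eq0 gt_eqF.
  by have := dot_skew h u v; rewrite hu // hv // dotZl dotZr mulNr => /oppr_inj/(mulfI c0).
pose t := - (dot v v)^-1 *: lie v u.
have tH : t \in H.
  rewrite memvZ // memv_centralizer lie_ad (hu a aH) (hv a aH).
  by rewrite lieZl lieZ !liexx !scaler0 addr0.
have dt x : x \in H -> dot x t = - (m x / l).
  move=> xH; rewrite /t dotZr -dot_lie hv // dotZl -vv; field.
  by rewrite (gt_eqF l0) (gt_eqF (dot_gt0 v0)).
have ht0 : dot h t != 0.
  rewrite dt // oppr_eq0 mulf_neq0 ?invr_eq0 ?(gt_eqF l0) //.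
  by rewrite -oppr_eq0 gt_eqF.
exists t => //; split => //; first by apply: contraNneq ht0 => ->; rewrite dotC dot0l.
exists u, v; split => // x xH; rewrite dt // opprK hu // hv //.
Qed.

Lemma span_roots (Phi : seq L) : (forall t, t \in Phi <-> root t) -> <<Phi>>%VS = H.
Proof.
move=> PhiP; apply: subspace_eq_orthogonal.
  by apply/span_subvP => t /PhiP[].
move=> h hH orth; apply/eqP/negPn/negP => /(root_nonorthogonal hH)[t rt].
by rewrite dotC orth ?eqxx // memv_span //; exact/PhiP.
Qed.

(** The pair p, q is assembled from the weight pairs of the indecomposable roots;
    the coefficients c are chosen so that the positive integer relation between
    these roots becomes [p, q] = 0. *)
Theorem orthogonal_regular : exists b, regular b /\
  forall x y, x \in centralizer a -> y \in centralizer b -> dot x y = 0.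
Proof.
have [Phi PhiP] := root_enum.
have PhiN t : t \in Phi -> - t \in Phi by move=> /PhiP/rootN/PhiP.
have gB : {morph dot a : x y / x - y} by move=> x y; exact: dotBr.
have g0 t : t \in Phi -> dot a t != 0 by move=> /PhiP; exact: root_value_neq0.
pose S := indecomposables Phi (dot a).
have uS : uniq S by rewrite filter_uniq // undup_uniq.
have Sroot t : t \in S -> root t by move=> /indecomposables_sub/PhiP.
have SH t : t \in S -> t \in H by move=> /Sroot[].
have S0 t : t \in S -> t != 0 by move=> /Sroot[].
have Sdiff t s : t \in S -> s \in S -> t != s -> ~ root (t - s).
  by move=> tS sS ts /PhiP; apply/negP; exact: (indecomposables_diff PhiN gB g0).
have uv t : {p : L * L | t \in S -> p.1 != 0 /\ weight_pair t p.1 p.2}.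
  apply: cid; have [/Sroot[_ _ [u [v uv]]]|_] := boolP (t \in S); last by exists (0, 0).
  by exists (u, v).
pose u t := (sval (uv t)).1; pose v t := (sval (uv t)).2.
have wp t : t \in S -> weight_pair t (u t) (v t) by move=> tS; exact: (svalP (uv t) tS).2.
have N0 t : t \in S -> 0 < dot (v t) (v t).
  move=> tS; rewrite -(weight_pair_norm (SH _ tS) (S0 _ tS) (wp _ tS)).
  by apply: dot_gt0; exact: (svalP (uv t) tS).1.
have [m [m0 mrel]] := indecomposables_relation PhiN g0.
(* c t ^+ 2 * <v t, v t> = m t *)
pose c t := Num.sqrt ((m t)%:R / dot (v t) (v t)).
have c0 t : t \in S -> c t != 0.
  by move=> tS; rewrite gt_eqF // sqrtr_gt0 divr_gt0 ?ltr0n // N0.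
have cc t : t \in S -> c t * (c t * dot (v t) (v t)) = (m t)%:R.
  move=> tS; rewrite mulrA -expr2 sqr_sqrtr ?divfK ?gt_eqF ?N0 //.
  by rewrite divr_ge0 ?ler0n // ltW // N0.
pose p := \sum_(t <- S) c t *: u t; pose q := \sum_(t <- S) c t *: v t.
have key s : s \in S ->
    lie p (v s) - lie q (u s) = (c s * dot (v s) (v s) *+ 2) *: s.
  move=> sS; rewrite !lie_suml -sumrB (bigD1_seq s) //= big1_seq => [|t /andP[ts tS]].
    rewrite addr0 !lieZl (lieC (v s)) scalerN opprK.
    rewrite (weight_pair_lie (SH _ sS) (S0 _ sS) (wp _ sS)) scalerA -scalerDl.
    by rewrite mulr2n.
  have cross := weight_pair_cross0 (SH _ tS) (SH _ sS) ts (Sdiff _ _ tS sS ts)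
    (wp _ tS) (wp _ sS).
  by rewrite !lieZl -scalerBr cross subrr scaler0.
have pq : lie p q = 0.
  have two : lie p q *+ 2 = 0.
    rewrite mulr2n {2}(lieC p q) {1}/q {2}/p !lie_sum -sumrB.
    rewrite (eq_big_seq (fun s => s *+ m s *+ 2)) => [|s sS].
      by rewrite sumrMnl mrel mul0rn.
    rewrite !lieZ -scalerBr key // scalerA mulrnAr cc // -mulrnA scaler_nat.
    by rewrite mulrnA.
  by move/eqP: two; rewrite -scaler_nat scaler_eq0 pnatr_eq0 => /eqP.
have [b [rb hb]] := commuting_regular pq.
exists b; split => // x y xH yb; have [py qy] := hb y yb.
have yS s : s \in S -> dot s y = 0.
  move=> sS; have := congr1 (dot y) (key s sS).
  rewrite dotBr -!dot_lie (lieC y p) (lieC y q) py qy oppr0 !dot0l subr0 dotZr.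
  move=> /esym/eqP; rewrite mulf_eq0 mulrn_eq0 mulf_eq0 /= (negPf (c0 _ sS)).
  by rewrite gt_eqF ?N0 //= dotC => /eqP.
have yPhi t : t \in Phi -> dot t y = 0.
  move=> tP; have [k ->] := indecomposables_span g0 tP.
  rewrite dot_suml big1_seq // => s /andP[_ sS].
  by rewrite -scaler_nat dotZl yS // mulr0.
rewrite -(span_roots PhiP) in xH.
rewrite (coord_span (X := in_tuple Phi) xH) dot_suml big1 // => i _.
by rewrite dotZl yPhi ?mulr0 // mem_nth.
Qed.

End CompactAlgebra.

(** * The Killing form of a compact semisimple Lie algebra as inner product *)

Theorem corollary1p6 (R : realType) (L : lieAlgebraType R)
    (hL : compact_semisimple L) (a : L) (ha : regular a) :
  exists b : L,
    [/\ regular b,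
        fullv = (limg (ad a) + limg (ad b))%VS,
        orthogonal_vect a b
      & orthogonal_space (centralizer a) (centralizer b)].
Proof.
have dot_gt0 (x : L) : x != 0 -> 0 < neg_killing x x := neg_killing_gt0 hL.
have nkC (x y : L) : neg_killing x y = neg_killing y x.
  by rewrite /neg_killing killingC.
have nkP (c : R) (x y z : L) :
    neg_killing (c *: x + y) z = c * neg_killing x z + neg_killing y z.
  by rewrite /neg_killing killingP opprD mulrN.
have nk_lie (x y z : L) : neg_killing (lie x y) z = neg_killing x (lie y z).
  by rewrite /neg_killing killing_inv.
have centerless (x : L) : (forall y, lie x y = 0) -> x = 0.
  move=> xc; apply: (dot_eq0 dot_gt0); rewrite neg_killing_ad0 //.
  by apply/lfunP => y; rewrite adE xc lfunE.
have [b [rb orth]] := orthogonal_regular nkC nkP nk_lie dot_gt0 centerless ha.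
exists b; split => //; last first.
  by apply: orth; rewrite memv_centralizer liexx.
(* an element orthogonal to both images lies in both centralizers, which are
   orthogonal to each other, so it is orthogonal to itself *)
symmetry; apply: (subspace_eq_orthogonal nkC nkP) => [|x _ xorth]; first exact: subvf.
have cent c : (limg (ad c) <= limg (ad a) + limg (ad b))%VS -> x \in centralizer c.
  move=> /subvP le_sum; rewrite memv_centralizer; apply/eqP/(dot_eq0 dot_gt0)/oppr_inj.
  rewrite -(dot_skew nkP nk_lie) oppr0; apply: xorth; apply: le_sum.
  by rewrite -adE memv_img // memvf.
by apply: (dot_eq0 dot_gt0); apply: orth; apply: cent; [exact: addvSl|exact: addvSr].
Qed.
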